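(* Let $(u_1^\varepsilon,u_2^\varepsilon)$ be the viscosity solution of the system $$(u^\varepsilon_{1})_t + H_{1}\big(\tfrac{x}{\varepsilon},Du^\varepsilon_{1}\big)+\tfrac{1}{\varepsilon}(u^\varepsilon_{1}-u^\varepsilon_{2})=0,\qquad (u^\varepsilon_{2})_t + H_{2}\big(\tfrac{x}{\varepsilon},Du^\varepsilon_{2}\big)+\tfrac{1}{\varepsilon}(u^\varepsilon_{2}-u^\varepsilon_{1})=0\quad\text{in }\mathbb{R}^n\times(0,T),$$ with $u_i^\varepsilon(x,0)=f_i(x)$ on $\mathbb{R}^n$ for $i=1,2$. Then, as $\varepsilon\to0$, the functions $u_1^\varepsilon$ and $u_2^\varepsilon$ converge locally uniformly in $\mathbb{R}^n\times(0,T)$ to the same limit $u\in C^{0,1}(\mathbb{R}^n\times[0,T])$, and $u$ is the viscosity solution of $$\begin{cases}u_t+\overline{H}(Du)=0 & \text{in }\mathbb{R}^n\times(0,T),\\ u(x,0)=\overline{f}(x):=\dfrac{f_1(x)+f_2(x)}{2} & \text{on }\mathbb{R}^n.\end{cases}$$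
   Context: Fix $T>0$ and $\varepsilon>0$. The Hamiltonians $H_1,H_2:\mathbb{R}^n\times\mathbb{R}^n\to\mathbb{R}$, $(\xi,p)\mapsto H_i(\xi,p)$, are continuous, satisfy the coercivity condition $\lim_{r\to\infty}\inf\{H_i(\xi,p):\xi\in\mathbb{R}^n,\ |p|\ge r\}=\infty$, and are periodic in $\xi$: $H_i(\xi+z,p)=H_i(\xi,p)$ for all $\xi,p\in\mathbb{R}^n$, $z\in\mathbb{Z}^n$. The initial data $f_1,f_2\in C^1(\mathbb{R}^n)$ have bounded gradients, $\|Df_i\|_{L^\infty(\mathbb{R}^n)}<\infty$. All solutions of equations and systems are viscosity solutions (for a system, the viscosity inequality is imposed on each component with the other component inserted as a given function); the comparison principle for these problems is taken as known, and ''the solution'' is the unique viscosity solution it provides. $C^{0,1}$ denotes Lipschitz continuous functions. Effective Hamiltonian: for each $P\in\mathbb{R}^n$ it is known that there is a unique constant $\overline{H}(P)$ such that the cell problem $$H_1(\xi,P+Dv_1(\xi))+v_1(\xi)-v_2(\xi)=\overline{H}(P),\qquad H_2(\xi,P+Dv_2(\xi))+v_2(\xi)-v_1(\xi)=\overline{H}(P)\quad\text{in }\mathbb{R}^n$$ admits a $\mathbb{Z}^n$-periodic continuous viscosity solution $(v_1,v_2)$. *)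

(* Defs.v *)
From mathcomp Require Export all_boot all_order all_algebra.
From mathcomp Require Export all_classical all_reals all_analysis.

Set Implicit Arguments.
Unset Strict Implicit.
Unset Printing Implicit Defensive.

Export Order.TTheory GRing.Theory Num.Theory.
Export numFieldNormedType.Exports.

Local Open Scope classical_set_scope.
Local Open Scope ring_scope.

(* Points of R^n are row vectors and points of space-time are pairs (x, t).
   The library norm on 'rV[R]_n is the sup norm; the notions below involving a
   norm (coercivity, bounded gradient, linear growth, Lipschitz continuity) do
   not depend on the choice of a norm on R^n. *)

Section ViscositySolutions.
Context {R : realType} {V : normedModType R}.

(* For finite-dimensional V, continuity of x |-> 'D_v phi x for every v is
   continuity of the differential. *)
Definition C1_on (Omega : set V) (phi : V -> R) : Prop :=
  forall x, Omega x -> differentiable phi x /\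
    forall v, {for x, continuous (fun y => 'D_v phi y)}.

Definition touches_above (u phi : V -> R) (x : V) : Prop :=
  \forall y \near x, u y - phi y <= u x - phi x.

Definition touches_below (u phi : V -> R) (x : V) : Prop :=
  \forall y \near x, u x - phi x <= u y - phi y.

(* The equation is F = 0 in the open set Omega.  F phi x is its left-hand side
   at x, with the derivatives of the unknown replaced by those of the test
   function phi; the zeroth-order terms (including the other component of a
   system) are those of the given functions and sit inside F. *)
Definition viscosity_subsolution (Omega : set V) (F : (V -> R) -> V -> R)
    (u : V -> R) : Prop :=
  forall phi x, C1_on Omega phi -> Omega x -> touches_above u phi x ->
    F phi x <= 0.

Definition viscosity_supersolution (Omega : set V) (F : (V -> R) -> V -> R)
    (u : V -> R) : Prop :=
  forall phi x, C1_on Omega phi -> Omega x -> touches_below u phi x ->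
    0 <= F phi x.

Definition viscosity_solution (Omega : set V) (F : (V -> R) -> V -> R)
    (u : V -> R) : Prop :=
  viscosity_subsolution Omega F u /\ viscosity_supersolution Omega F u.

End ViscositySolutions.

Section HamiltonJacobi.
Context {R : realType} {n : nat}.
Implicit Types (H : 'rV[R]_n -> 'rV[R]_n -> R) (f : 'rV[R]_n -> R).
Implicit Types (u : 'rV[R]_n * R -> R) (T eps : R).

Definition grad f (x : 'rV[R]_n) : 'rV[R]_n :=
  \row_i 'D_(delta_mx 0 i) f x.

Definition space_grad u (p : 'rV[R]_n * R) : 'rV[R]_n :=
  \row_i 'D_((delta_mx 0 i : 'rV[R]_n, 0 : R)) u p.

Definition time_deriv u (p : 'rV[R]_n * R) : R :=
  'D_((0 : 'rV[R]_n, 1 : R)) u p.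

Definition coercive H : Prop :=
  ereal_inf [set (H z.1 z.2)%:E | z in [set z | r <= `|z.2|]]
    @[r --> +oo%R] --> +oo%E.

Definition integer_periodic f : Prop :=
  forall (xi : 'rV[R]_n) (z : 'rV[int]_n),
    f (xi + map_mx (fun k : int => k%:~R) z) = f xi.

Definition hamiltonian H : Prop :=
  [/\ continuous (fun z : 'rV[R]_n * 'rV[R]_n => H z.1 z.2),
      coercive H
    & forall p, integer_periodic (H^~ p)].

Definition initial_datum f : Prop :=
  C1_on setT f /\ exists M : R, forall x, `|grad f x| <= M.

Definition cell_solvable H1 H2 (P : 'rV[R]_n) (c : R) : Prop :=
  exists v1 v2 : 'rV[R]_n -> R,
  [/\ continuous v1 /\ continuous v2,
      integer_periodic v1 /\ integer_periodic v2,
      viscosity_solution setT (fun phi xi =>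
        H1 xi (P + grad phi xi) + v1 xi - v2 xi - c) v1
    & viscosity_solution setT (fun phi xi =>
        H2 xi (P + grad phi xi) + v2 xi - v1 xi - c) v2].

Definition effective_hamiltonian H1 H2 (Hbar : 'rV[R]_n -> R) : Prop :=
  forall P, cell_solvable H1 H2 P (Hbar P) /\
    forall c, cell_solvable H1 H2 P c -> c = Hbar P.

Definition open_strip T : set ('rV[R]_n * R) := [set p | 0 < p.2 < T].

Definition initial_strip T : set ('rV[R]_n * R) := [set p | 0 <= p.2 < T].

Definition closed_strip T : set ('rV[R]_n * R) := [set p | 0 <= p.2 <= T].

(* Solutions of the Cauchy problems are continuous up to t = 0 and grow at most
   linearly in x, as the data do.  On the unbounded domain R^n a growth
   condition is part of the comparison principle, hence of the meaning of
   "the" viscosity solution. *)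
Definition linear_growth T u : Prop :=
  exists K : R, forall p, initial_strip T p -> `|u p| <= K * (1 + `|p.1|).

Definition cauchy_class T f u : Prop :=
  [/\ {within initial_strip T, continuous u},
      linear_growth T u
    & forall x, u (x, 0) = f x].

Definition system_solution H1 H2 f1 f2 T eps u1 u2 : Prop :=
  [/\ cauchy_class T f1 u1,
      cauchy_class T f2 u2,
      viscosity_solution (open_strip T) (fun phi p =>
        time_deriv phi p + H1 (eps^-1 *: p.1) (space_grad phi p)
          + eps^-1 * (u1 p - u2 p)) u1
    & viscosity_solution (open_strip T) (fun phi p =>
        time_deriv phi p + H2 (eps^-1 *: p.1) (space_grad phi p)
          + eps^-1 * (u2 p - u1 p)) u2].

Definition effective_solution (Hbar : 'rV[R]_n -> R) f T u : Prop :=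
  cauchy_class T f u /\
  viscosity_solution (open_strip T) (fun phi p =>
    time_deriv phi p + Hbar (space_grad phi p)) u.

Definition locally_uniform_cvg (Omega : set ('rV[R]_n * R))
    (ueps : R -> 'rV[R]_n * R -> R) u : Prop :=
  forall K : set ('rV[R]_n * R), compact K -> K `<=` Omega ->
    {uniform K, ueps eps @[eps --> 0^'+] --> u}.

End HamiltonJacobi.

(* Main.v *)
Require Import Defs.
From HB Require Import structures.
From mathcomp Require Import ring lra.

Set Implicit Arguments.
Unset Strict Implicit.
Unset Printing Implicit Defensive.

Local Open Scope classical_set_scope.
Local Open Scope ring_scope.

(* Half-relaxed limits and Evans' perturbed test function method.  The functions
   w_i = f_bar +- (f_1 - f_2) exp(-2t/eps)/2 solve the linear part of the system,
   so w_i +- Ct are barriers and |u_i - w_i| <= Ct with C independent of eps.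
   Hence the half-relaxed limits U >= L of (u_1, u_2) stay within Ct of f_bar for
   t > 0.  Testing the system against phi + eps v(x/eps), with v a corrector,
   shows that U is a sub- and L a supersolution of the effective equation; the
   second claim is the first one for -u and the Hamiltonian -H(x, -p).  Comparing
   two cell problems shows that Hbar is continuous, and doubling variables then
   yields U(x,t) - L(y,s) <= A |x - y| + C |t - s|, which gives U = L, its
   Lipschitz continuity and, by the same argument, uniqueness. *)

(** * Test functions *)

(** Since f_1 and f_2 may differ, the solutions can change by order one within a time of order eps,
    so convergence need not be uniform up to t = 0. The initial values of the limit come from
    barriers containing this layer exactly: only the Hamiltonian remains to be absorbed, which makes
    C independent of the stiff coupling 1/eps. Gradients are controlled at the maximum points only.
    There the test on u bounds H(x/eps, p) from above and the corrector bounds it from below, at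
    nearly the same p. For coercive H the first bound controls p; for -H(x, -p), which tends to
    minus infinity, the second does. One condition using both bounds therefore serves both
    Hamiltonians. The strength k of the coupling is kept as a parameter: k = 1/eps is the system,
    and k = 0 the scalar effective equation, whose solutions thereby receive the growth bounds that
    uniqueness requires. *)

Section TestFunctions.
Context {R : realType}.
Implicit Types V W : normedModType R.

(** The derivative is carried along as an explicit [D], so that gradients of composite test
    functions come out of the rules below instead of being recomputed from ['D_v]. *)
Definition C1_with V (Omega : set V) (phi : V -> R) (D : V -> V -> R) :=
  forall x, Omega x -> is_diff x phi (D x) /\
    forall v, {for x, continuous (fun y => D y v)}.

Lemma C1_with_sub V (A B : set V) phi D :
  A `<=` B -> C1_with B phi D -> C1_with A phi D.
Proof. by move=> AB h x /AB /h. Qed.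

Lemma C1_with_ext V (A : set V) phi D psi E :
  phi =1 psi -> (forall x v, D x v = E x v) ->
  C1_with A phi D -> C1_with A psi E.
Proof.
by move=> /funext <- DE; suff -> : D = E by []; do 2!apply/funext => ?.
Qed.

Lemma C1_with_derive V (Omega : set V) phi D x v :
  C1_with Omega phi D -> Omega x -> 'D_v phi x = D x v.
Proof.
move=> h /h [dphi _]; rewrite deriveE; last exact: ex_diff.
by rewrite (@diff_val _ _ _ _ _ _ _ dphi).
Qed.

Lemma C1_with_C1 V (Omega : set V) phi D :
  open Omega -> C1_with Omega phi D -> C1_on Omega phi.
Proof.
move=> oO h x Ox; have [dphi cD] := h x Ox; split; first exact: ex_diff.
move=> v; rewrite /prop_for /continuous_at (C1_with_derive v h Ox).
apply: cvg_trans (cD v); apply: near_eq_cvg.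
near=> y; apply/esym/(C1_with_derive v h); near: y.
exact: open_nbhs_nbhs.
Unshelve. all: by end_near. Qed.

Lemma C1_on_with V (Omega : set V) phi :
  C1_on Omega phi -> C1_with Omega phi (fun x v => 'D_v phi x).
Proof.
move=> h x /h[dphi cD]; split=> //.
apply: is_diff_eq (differentiableP dphi) _.
by apply/funext => v; rewrite deriveE.
Qed.

Lemma C1_withD V (Omega : set V) phi psi D E :
  C1_with Omega phi D -> C1_with Omega psi E ->
  C1_with Omega (fun x => phi x + psi x) (fun x v => D x v + E x v).
Proof.
move=> h k x Ox; have [dD cD] := h x Ox; have [dE cE] := k x Ox; split.
  exact: (@is_diffD _ _ _ phi psi (D x) (E x)).
by move=> v; apply: continuousD; [exact: cD|exact: cE].
Qed.

Lemma C1_with_cst V (Omega : set V) c :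
  C1_with Omega (fun=> c) (fun _ _ => 0).
Proof.
by move=> x _; split; [exact: (@is_diff_cst _ _ _ c)|move=> v; exact: cst_continuous].
Qed.

Lemma C1_withM V (Omega : set V) phi psi D E :
  C1_with Omega phi D -> C1_with Omega psi E ->
  C1_with Omega (fun x => phi x * psi x)
    (fun x v => phi x * E x v + psi x * D x v).
Proof.
move=> h k x Ox; have [dD cD] := h x Ox; have [dE cE] := k x Ox; split.
  exact: (@is_diffM _ _ phi psi (D x) (E x)).
move=> v; apply: continuousD; apply: continuousM => //;
  by apply: differentiable_continuous; exact: ex_diff.
Qed.

Lemma C1_withZ V (Omega : set V) c phi D :
  C1_with Omega phi D ->
  C1_with Omega (fun x => c * phi x) (fun x v => c * D x v).
Proof.
move=> h; apply: (C1_with_ext _ _ (C1_withM (C1_with_cst (Omega := Omega) c) h)) => //=.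
by move=> x v; rewrite mulr0 addr0.
Qed.

Lemma C1_withN V (Omega : set V) phi D :
  C1_with Omega phi D -> C1_with Omega (fun x => - phi x) (fun x v => - D x v).
Proof.
move=> h; apply: (C1_with_ext _ _ (C1_withZ (-1) h)) => /= [x|x v];
  by rewrite mulN1r.
Qed.

Lemma C1_with_sum V (Omega : set V) n (phi : 'I_n -> V -> R) D :
  (forall i, C1_with Omega (phi i) (D i)) ->
  C1_with Omega (fun x => \sum_i phi i x) (fun x v => \sum_i D i x v).
Proof.
elim: n phi D => [|n IH] phi D h.
  apply: (C1_with_ext _ _ (C1_with_cst 0)) => [x|x v]; by rewrite big_ord0.
have := C1_withD (h ord0) (IH _ _ (fun i => h (lift ord0 i))).
by apply: C1_with_ext => [x|x v]; rewrite big_ord_recl.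
Qed.

(** The conditions on [h] are imposed at the values [phi x] only, so [h] may be singular elsewhere,
    as the barrier [e / (T - t)] is at [t = T]. *)
Lemma C1_with_comp V (Omega : set V) phi D (h h' : R -> R) :
  C1_with Omega phi D ->
  (forall x, Omega x -> is_derive (phi x) (1 : R) h (h' (phi x)) /\
     {for phi x, continuous h'}) ->
  C1_with Omega (fun x => h (phi x)) (fun x v => h' (phi x) * D x v).
Proof.
move=> k hh x Ox; have [dD cD] := k x Ox; have [dh ch] := hh x Ox; split.
  have h1 : is_diff (phi x) h (fun v => v * h' (phi x)).
    have [dh1 dh2] := dh.
    have dfh : differentiable h (phi x) by apply/derivable1_diffP.
    apply: (is_diff_eq (f' := 'd h (phi x))); first exact: differentiableP dfh.
    by rewrite deriv1E// derive1E dh2.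
  rewrite (_ : (fun v => _ * D x v) = (fun v => v * h' (phi x)) \o D x).
    exact: is_diff_comp.
  by apply/funext => v /=; rewrite mulrC.
move=> v; apply: continuousM => //.
apply: (@continuous_comp _ _ _ phi h') => //.
by apply: differentiable_continuous; exact: ex_diff.
Qed.

Lemma C1_with_affine V W (A : set W) (Omega : set V) phi D (g : W -> V) dg :
  (forall x, A x -> Omega (g x)) -> (forall x, is_diff x g dg) ->
  C1_with Omega phi D ->
  C1_with A (fun x => phi (g x)) (fun x v => D (g x) (dg v)).
Proof.
move=> AO gd h x Ax; have [dD cD] := h _ (AO _ Ax); split.
  exact: (@is_diff_comp _ _ _ _ g dg phi (D (g x)) x).
move=> v; apply: (@continuous_comp _ _ _ g (fun y => D y (dg v))) => //.
by apply: differentiable_continuous; exact: ex_diff.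
Qed.

End TestFunctions.

(** Linearity is a proposition here; packing it into a [{linear V -> W}] gives access to the fact
    that a continuous linear map is its own differential. *)
Lemma is_diff_of_linear {R : numFieldType} (V W : normedModType R) (f : V -> W) x :
  linear f -> continuous f -> is_diff x f f.
Proof.
move=> lf cf; pose m := GRing.isLinear.Build _ _ _ _ _ lf.
pose g : {linear V -> W} := HB.pack f m.
have dg : differentiable g x by apply: linear_differentiable; exact: cf.
rewrite -[f]/(g : _ -> _); apply: DiffDef => //.
by apply: diff_lin; exact: cf.
Qed.

Section SpaceTime.
Context {R : realType} {n : nat}.
Notation V := 'rV[R]_n.
Notation S := ('rV[R]_n * R)%type.

Lemma C1_with_coord (Omega : set S) i :
  C1_with Omega (fun p => p.1 0 i) (fun _ v => v.1 0 i).
Proof.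
move=> p _; split; last by move=> v; exact: cst_continuous.
apply: is_diff_of_linear => [a u v|]; first by rewrite /= !mxE.
move=> q; apply: (@continuous_comp _ _ _ fst (fun y : V => y 0 i)).
  exact: cvg_fst.
exact: coord_continuous.
Qed.

Lemma C1_with_time (Omega : set S) : C1_with Omega snd (fun _ v => v.2).
Proof.
move=> p _; split; last by move=> v; exact: cst_continuous.
by apply: is_diff_of_linear => // q; exact: cvg_snd.
Qed.

Lemma C1_with_coordV (Omega : set V) i :
  C1_with Omega (fun x => x 0 i) (fun _ v => v 0 i).
Proof.
move=> p _; split; last by move=> v; exact: cst_continuous.
apply: is_diff_of_linear => [a u v|]; first by rewrite /= !mxE.
exact: coord_continuous.
Qed.

Lemma C1_with_fst (Omega : set S) (f : V -> R) D :
  C1_with setT f D -> C1_with Omega (fun p => f p.1) (fun p v => D p.1 v.1).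
Proof.
apply: C1_with_affine => // x.
by apply: is_diff_of_linear => // q; exact: cvg_fst.
Qed.

Definition C1_fun (h h' : R -> R) :=
  (forall s, is_derive s (1 : R) h (h' s)) /\ continuous h'.

Lemma C1_with_sep (Omega : set S) (h h' : 'I_n -> R -> R) :
  (forall i, C1_fun (h i) (h' i)) ->
  C1_with Omega (fun p => \sum_i h i (p.1 0 i))
    (fun p v => \sum_i h' i (p.1 0 i) * v.1 0 i).
Proof.
move=> hh; apply: C1_with_sum => i.
apply: (C1_with_comp (C1_with_coord (Omega:=Omega) i)) => p _.
by split; [exact: (hh i).1|exact: (hh i).2].
Qed.

Lemma C1_with_sepV (Omega : set V) (h h' : 'I_n -> R -> R) :
  (forall i, C1_fun (h i) (h' i)) ->
  C1_with Omega (fun x => \sum_i h i (x 0 i))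
    (fun x v => \sum_i h' i (x 0 i) * v 0 i).
Proof.
move=> hh; apply: C1_with_sum => i.
apply: (C1_with_comp (C1_with_coordV (Omega:=Omega) i)) => p _.
by split; [exact: (hh i).1|exact: (hh i).2].
Qed.

Lemma C1_with_timefun (Omega : set S) (k k' : R -> R) :
  (forall p, Omega p -> is_derive p.2 (1 : R) k (k' p.2) /\
     {for p.2, continuous k'}) ->
  C1_with Omega (fun p => k p.2) (fun p v => k' p.2 * v.2).
Proof. exact: (C1_with_comp (C1_with_time (Omega:=Omega))). Qed.

Lemma sum_delta (a : 'I_n -> R) j :
  \sum_i a i * (delta_mx 0 j : V) 0 i = a j.
Proof.
rewrite (bigD1 j)//= mxE !eqxx mulr1 big1 ?addr0// => i ij.
by rewrite mxE (negPf ij) andbF mulr0.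
Qed.

Lemma sum_zero (a : 'I_n -> R) : \sum_i a i * (0 : V) 0 i = 0.
Proof. by rewrite big1// => i _; rewrite mxE mulr0. Qed.

Definition dirx (j : 'I_n) : S := (delta_mx 0 j, 0).
Definition dirt : S := (0, 1).

Lemma C1_with_space_grad (Omega : set S) phi D p :
  C1_with Omega phi D -> Omega p -> space_grad phi p = \row_j D p (dirx j).
Proof.
by move=> h Op; apply/rowP => j; rewrite !mxE (C1_with_derive _ h).
Qed.

Lemma C1_with_time_deriv (Omega : set S) phi D p :
  C1_with Omega phi D -> Omega p -> time_deriv phi p = D p dirt.
Proof. by move=> h Op; rewrite /time_deriv (C1_with_derive _ h). Qed.

Lemma C1_with_grad (Omega : set V) phi D x :
  C1_with Omega phi D -> Omega x ->
  grad phi x = \row_j D x (delta_mx 0 j).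
Proof.
by move=> h Op; apply/rowP => j; rewrite !mxE (C1_with_derive _ h).
Qed.

Lemma open_open_strip (T : R) : open (open_strip T : set S).
Proof.
have -> : (open_strip T : set S) = snd @^-1` (`]0, T[%classic : set R).
  by apply/seteqP; split => p /=; rewrite in_itv.
apply: open_comp; last exact: interval_open.
by move=> p _; exact: cvg_snd.
Qed.

End SpaceTime.

(** * Semicontinuity and Hamiltonians *)

Section Semicontinuity.
Context {R : realType} {X : topologicalType}.
Implicit Types (A K : set X) (f g : X -> R).

(** Semicontinuity of the restriction to [A]: solutions and relaxed limits carry no information
    outside the strip, so neighbours outside [A] are exempted. *)
Definition usc_in A f := forall p, A p -> forall c, f p < c ->
  \forall q \near p, A q -> f q < c.

Lemma usc_in_sub A B f : A `<=` B -> usc_in B f -> usc_in A f.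
Proof.
by move=> AB h p /AB Bp c fc; apply: filterS (h p Bp c fc) => q + /AB; apply.
Qed.

Lemma usc_inD A f g : usc_in A f -> usc_in A g -> usc_in A (fun p => f p + g p).
Proof.
move=> hf hg p Ap c fgc; pose e := (c - f p - g p) / 2.
have f1 : f p < f p + e by rewrite /e; lra.
have g1 : g p < g p + e by rewrite /e; lra.
apply: filterS2 (hf p Ap _ f1) (hg p Ap _ g1) => q fq gq Aq.
by move: (fq Aq) (gq Aq); rewrite /e; lra.
Qed.

Lemma continuous_usc_in A f : (forall p, A p -> {for p, continuous f}) -> usc_in A f.
Proof.
move=> cf p Ap c fc.
have : \forall q \near p, f q < c by exact: (cvgr_lt (f p) (cf p Ap)).
by apply: filterS.
Qed.

Lemma within_continuous_usc_in A f : {within A, continuous f} -> usc_in A f.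
Proof.
move=> /subspace_continuousP cf p Ap c fc.
exact: (cvgr_lt (f p) (cf p Ap)).
Qed.

(* Upper sets {i in K | f q <= f i} form a filter base; were there no maximum,
   near-covering along this filter would give f q < f q. *)
Lemma usc_max_compact K f : compact K -> K !=set0 -> usc_in K f ->
  exists2 p, K p & forall q, K q -> f q <= f p.
Proof.
move=> /compact_near_coveringP cK [k0 Kk0] uf; apply: contrapT => nomax.
have up p : K p -> exists2 q, K q & f p < f q.
  move=> Kp; apply: contrapT => h; apply: nomax; exists p => // q Kq.
  by rewrite leNgt; apply/negP => pq; apply: h; exists q.
pose F : set_system X := fun B => exists2 q, K q & forall i, K i -> f q <= f i -> B i.
have FF : Filter F.
  split; first by exists k0.
    move=> P Q [p Kp hp] [q Kq hq]; have [pq|/ltW qp] := leP (f p) (f q).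
      by exists q => // i Ki qi; split; [apply: hp => //; exact: le_trans pq qi|exact: hq].
    by exists p => // i Ki pi; split; [exact: hp|apply: hq => //; exact: le_trans qp pi].
  by move=> P Q PQ [p Kp hp]; exists p => // i Ki pi; apply/PQ/hp.
have := cK _ F (fun i x => K x -> f x < f i) FF.
case.
  move=> x Kx; have [q Kq xq] := up x Kx.
  exists ([set y | K y -> f y < f q], [set i | f q <= f i]).
    by split; [exact: uf|exists q].
  by move=> [y i] /= [h qi] Ky; exact: lt_le_trans (h Ky) qi.
by move=> q Kq /(_ q Kq (lexx _) q Kq Kq); rewrite ltxx.
Qed.

(** Maximizing over the component together with the point orders [f i p] and [f (~~ i) p] at the
    maximum; this ordering is what controls the coupling terms of the system. *)
Lemma usc_max_compact2 K (f : bool -> X -> R) : compact K -> K !=set0 ->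
  (forall i, usc_in K (f i)) ->
  exists i p, K p /\ forall j q, K q -> f j q <= f i p.
Proof.
move=> cK K0 uf.
have [p Kp hp] := usc_max_compact cK K0 (uf true).
have [q Kq hq] := usc_max_compact cK K0 (uf false).
have [pq|/ltW qp] := leP (f true p) (f false q).
  exists false, q; split=> // -[] r Kr; last exact: hq.
  exact: le_trans (hp _ Kr) pq.
exists true, p; split=> // -[] r Kr; first exact: hp.
exact: le_trans (hq _ Kr) qp.
Qed.

End Semicontinuity.

Lemma usc_in_comp {R : realType} (X Y : topologicalType) (A : set X) (B : set Y)
    (f : X -> R) (g : Y -> X) :
  (forall y, B y -> A (g y)) -> (forall y, B y -> {for y, continuous g}) ->
  usc_in A f -> usc_in B (fun y => f (g y)).
Proof.
move=> BA cg uf y By c fc.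
have := uf _ (BA _ By) c fc => h.
have hy : \forall z \near y, A (g z) -> f (g z) < c := cg y By _ h.
by apply: filterS hy => z + Bz; apply; exact: BA.
Qed.

(** * Consequences of periodicity and coercivity *)

Section Hamiltonians.
Context {R : realType} {n : nat}.
Notation V := 'rV[R]_n.
Implicit Types H : V -> V -> R.

Definition locally_bounded_in_p H := forall r, exists C, forall xi p,
  `|p| <= r -> `|H xi p| <= C.

(** [xi] ranges over the whole space: compactness in [xi] comes from periodicity, compactness in [p]
    from the bound [r]. *)
Definition unif_continuous_in_p H := forall r e, 0 < e -> exists2 d, 0 < d &
  forall xi xi' p p', `|p| <= r -> `|xi - xi'| <= d -> `|p - p'| <= d ->
    `|H xi p - H xi' p'| < e.

(* Satisfied by H and by its reflection as soon as H is coercive. *)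
Definition semicoercive H := forall C, exists r, forall xi xi' p p',
  `|p - p'| <= 1 -> H xi p <= C -> - C <= H xi' p' -> `|p| <= r.

Definition refl H : V -> V -> R := fun xi p => - H xi (- p).

Definition regular H :=
  [/\ locally_bounded_in_p H, unif_continuous_in_p H & semicoercive H].

Lemma normr_cball_compact (r : R) : compact [set x : V | `|x| <= r].
Proof.
apply: bounded_closed_compact.
  by exists r; split=> [|x rx y /= yr]; [exact: num_real|exact: le_trans yr (ltW rx)].
apply: (@closed_comp V R (fun x : V => `|x|) [set x : R | x <= r]).
  by move=> x _; exact: norm_continuous.
exact: closed_le.
Qed.

Lemma rVnorm_le (x : V) c : 0 <= c -> (forall i, `|x 0 i| <= c) -> `|x| <= c.
Proof.
move=> c0 h; rewrite [leLHS]/Num.norm /= mx_normrE; apply/bigmax_leP; split=> //=.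
by move=> [i j] _ /=; rewrite ord1.
Qed.

Lemma coord_le_norm (x : V) i : `|x 0 i| <= `|x|.
Proof.
rewrite [leRHS]/Num.norm /= mx_normrE.
by apply/bigmax_geP; right; exists (0, i).
Qed.

Lemma integer_part_vec (x : V) : exists z : 'rV[int]_n,
  `|x + map_mx (fun k : int => k%:~R) z| <= 1.
Proof.
exists (\row_i - Num.floor (x 0 i)); apply: rVnorm_le => // i.
rewrite !mxE; have := floor_le (x 0 i); have := lt_succ_floor (x 0 i).
rewrite intrD rmorphN /= => h1 h2.
by rewrite ger0_norm; lra.
Qed.

(** Both points are moved by the same integer vector, which preserves their difference; the vector
    is chosen to bring the first one into the unit ball. *)
Lemma periodic_reduce H xi xi' : (forall p, integer_periodic (H^~ p)) ->
  exists xi1 xi1', [/\ `|xi1| <= 1, xi1 - xi1' = xi - xi',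
    H xi = H xi1 & H xi' = H xi1'].
Proof.
move=> per; have [z hz] := integer_part_vec xi.
pose t : V := map_mx (fun k : int => k%:~R) z.
exists (xi + t), (xi' + t); split=> //.
- by rewrite opprD addrACA subrr addr0.
- by apply/funext => p; rewrite (per p xi z).
- by apply/funext => p; rewrite (per p xi' z).
Qed.

(** Heine-Cantor with only [a] in the compact set; [b] may lie outside, as the second point of
    [periodic_reduce] may. *)
Lemma unif_continuous_compact (W : normedModType R) (f : W -> R) K e :
  compact K -> continuous f -> 0 < e -> exists2 d, 0 < d &
    forall a b, K a -> `|a - b| <= d -> `|f a - f b| < e.
Proof.
move=> /compact_near_coveringP cK cf e0.
have := cK _ (0^'+ : set_system R)
  (fun d a => forall b, `|a - b| <= d -> `|f a - f b| < e) _.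
case.
  move=> a Ka.
  have : \forall b \near a, `|f a - f b| < e / 2.
    by have /cvgrPdist_lt := cf a; apply; rewrite divr_gt0.
  move=> /nbhs_normP [r /= r0 hr].
  exists ([set b | `|a - b| < r / 2], [set d | d < r / 2]).
    split; last by apply: nbhs_right_lt; rewrite divr_gt0.
    by apply/nbhs_normP; exists (r / 2) => //=; rewrite divr_gt0.
  move=> [b d] /= [ab dr] c bc.
  have /hr /= hb : `|a - b| < r by lra.
  have /hr /= hc : `|a - c| < r.
    by rewrite (le_lt_trans (ler_distD b _ _))//; lra.
  rewrite (le_lt_trans (ler_distD (f a) _ _))//.
  by rewrite (distrC (f b)); lra.
move=> r /= r0 h; exists (r / 2); first by rewrite divr_gt0.
move=> a b Ka; apply: h => //=; last by rewrite divr_gt0.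
by rewrite sub0r normrN gtr0_norm ?divr_gt0//; lra.
Qed.

Lemma norm_pair_le (U W : normedModType R) (a : U) (b : W) c :
  `|(a, b)| <= c <-> `|a| <= c /\ `|b| <= c.
Proof. by rewrite /Num.norm/= ge_max; split=> [/andP|/andP]. Qed.

Section Regularity.
Variable H : V -> V -> R.
Hypothesis hH : hamiltonian H.

Let K r := [set z : V * V | `|z.1| <= 1 /\ `|z.2| <= r].

Let K_compact r : compact (K r).
Proof.
have -> : K r = [set x : V | `|x| <= 1] `*` [set x : V | `|x| <= r].
  by apply/seteqP; split => -[].
by apply: compact_setX; exact: normr_cball_compact.
Qed.

Lemma hamiltonian_unif_continuous : unif_continuous_in_p H.
Proof.
have [cH _ per] := hH => r e e0.
have [d d0 hd] := unif_continuous_compact (@K_compact r) cH e0.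
exists d => // xi xi' p p' pr xid pd.
have [y [y' [y1 yy -> ->]]] := periodic_reduce xi xi' per.
apply: (hd (y, p) (y', p')); first by split.
by apply/norm_pair_le; rewrite /= yy.
Qed.

Lemma hamiltonian_locally_bounded : locally_bounded_in_p H.
Proof.
have [cH _ per] := hH => r.
pose f z := `|H z.1 z.2|.
have cf : continuous f by move=> z; apply: cvg_norm; exact: cH.
have uf : usc_in (K r) f by apply: continuous_usc_in => z _; exact: cf.
have [K0|K0] := pselect (K r !=set0); last first.
  exists 0 => xi p pr; exfalso; apply: K0; exists (0, p).
  by split=> //=; rewrite normr0.
have [z Kz hz] := usc_max_compact (@K_compact r) K0 uf.
exists (f z) => xi p pr.
have [y [y' [y1 yy -> _]]] := periodic_reduce xi xi per.
exact: (hz (y, p)).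
Qed.

Lemma hamiltonian_coercive C : exists r, forall xi p, H xi p <= C -> `|p| <= r.
Proof.
have [_ cH _] := hH.
move/cvgeyPgt: cH => /(_ C)[r [_ hr]]; exists (r + 1) => xi p HC.
rewrite leNgt; apply/negP => rp.
have /hr /= h : r < r + 1 by rewrite ltrDl.
suff : (C%:E < (H xi p)%:E)%E by rewrite lte_fin ltNge HC.
apply: lt_le_trans h _; apply: ereal_inf_lbound.
by exists (xi, p) => //=; exact: ltW.
Qed.

Lemma hamiltonian_regular : regular H.
Proof.
split.
- exact: hamiltonian_locally_bounded.
- exact: hamiltonian_unif_continuous.
- move=> C; have [r hr] := hamiltonian_coercive C.
  by exists r => xi xi' p p' _ HC _; exact: hr HC.
Qed.

(** For the reflection the roles in [semicoercive] are exchanged: [- C <= refl H xi' p'] means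
    [H xi' (- p') <= C], so coercivity of [H] bounds [p'], and [p] is at distance at most one from
    it. *)
Lemma hamiltonian_regular_refl : regular (refl H).
Proof.
split.
- move=> r; have [C hC] := hamiltonian_locally_bounded r.
  by exists C => xi p pr; rewrite /refl normrN hC// normrN.
- move=> r e e0; have [d d0 hd] := hamiltonian_unif_continuous r e0.
  exists d => // xi xi' p p' pr xid pd.
  rewrite /refl -opprD normrN; apply: hd => //; first by rewrite normrN.
  by rewrite -opprD normrN.
- move=> C; have [r hr] := hamiltonian_coercive C.
  exists (r + 1) => xi xi' p p' pp' _; rewrite /refl lerNl opprK => /hr.
  rewrite normrN => p'r; have := ler_normD (p - p') p'.
  by rewrite subrK; lra.
Qed.

End Regularity.

End Hamiltonians.

Lemma is_derive_ext {R : numFieldType} (V W : normedModType R) (x v : V) (f g : V -> W) df dg :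
  is_derive x v f df -> f =1 g -> df = dg -> is_derive x v g dg.
Proof. by move=> + /funext <- <-. Qed.

(** * One-variable penalties and barriers *)

Section OneVariable.
Context {R : realType}.
Implicit Types s c : R.

(** The Japanese bracket, a C^1 substitute for [|s - c|]: it dominates the absolute value, has slope
    at most one and equals 1 at its centre. Summed over the coordinates it penalizes infinity at the
    price of a bounded gradient. *)
Definition japanese c s : R := Num.sqrt (1 + (s - c) ^+ 2).
Definition japanese' c s : R := (s - c) / japanese c s.

Lemma japanese_gt0 c s : 0 < japanese c s.
Proof. by rewrite sqrtr_gt0 ltr_pwDl// sqr_ge0. Qed.

Lemma japanese_center c : japanese c c = 1.
Proof. by rewrite /japanese subrr expr0n addr0 sqrtr1. Qed.

Lemma japanese_ge c s : `|s - c| <= japanese c s.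
Proof. by rewrite -sqrtr_sqr ler_wsqrtr// lerDr. Qed.

Lemma japanese'_le1 c s : `|japanese' c s| <= 1.
Proof.
rewrite normrM normfV (gtr0_norm (japanese_gt0 _ _)).
by rewrite ler_pdivrMr ?japanese_gt0// mul1r japanese_ge.
Qed.

Lemma C1_fun_japanese c : C1_fun (japanese c) (japanese' c).
Proof.
have dg s : is_derive s (1:R) (fun s => 1 + (s - c) ^+ 2) (2 * (s - c)).
  apply: is_derive_eq.
  by rewrite /GRing.scale/=; ring.
have g0 s : 0 < 1 + (s - c) ^+ 2 by rewrite ltr_pwDl// sqr_ge0.
have dj s : is_derive s (1:R) (japanese c) (japanese' c s).
  have h := @is_derive1_comp R (@Num.sqrt R) (fun s => 1 + (s - c) ^+ 2) s _ _ (is_derive1_sqrt (g0 s)) (dg s).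
  apply: (is_derive_ext h) => //; rewrite /japanese' /japanese.
  set q := Num.sqrt _; have q0 : 0 < q by rewrite sqrtr_gt0.
  by field; rewrite gt_eqF.
split=> // s; apply: cvgM.
  by apply: cvgB; [exact: cvg_id|exact: cvg_cst].
apply: cvgV; first by rewrite gt_eqF// japanese_gt0.
apply: differentiable_continuous; apply/derivable1_diffP.
by have [] := dj s.
Qed.

Lemma C1_fun_sqr c m : C1_fun (fun s => m * (s - c) ^+ 2) (fun s => m * (2 * (s - c))).
Proof.
split=> [s|s].
  apply: is_derive_eq.
  by rewrite /GRing.scale/=; ring.
apply: cvgM; first exact: cvg_cst; apply: cvgM; first exact: cvg_cst.
by apply: cvgB; [exact: cvg_id|exact: cvg_cst].
Qed.

(** With [e > 0] this barrier blows up at [T], keeping maxima away from the final time, and its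
    positive derivative makes the inequalities strict. *)
Lemma barrier_derive (T e s : R) : s < T ->
  is_derive s (1 : R) (fun s => e / (T - s)) (e / (T - s) ^+ 2).
Proof.
move=> sT; have Ts : T - s != 0 by rewrite gt_eqF// subr_gt0.
have dTs : is_derive s (1 : R) (fun s => T - s) (-1).
  by apply: is_derive_eq; ring.
apply: (@is_derive_ext _ _ _ _ _ (fun s => e * (T - s)^-1) _ (e * ((T - s) ^- 2))) => //.
have h : is_derive s (1 : R) (fun s => (T - s)^-1) ((T - s) ^- 2).
  have [dd de] := dTs; split; first exact: derivableV.
  by rewrite deriveV// de /GRing.scale/= mulrN mulr1 opprK.
exact: (is_derive_ext (@is_deriveZ _ _ _ _ e _ _ _ h)).
Qed.

Lemma barrier_derive_continuous (T e s : R) : s < T ->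
  {for s, continuous (fun s => e / (T - s) ^+ 2)}.
Proof.
move=> sT; have Ts : T - s != 0 by rewrite gt_eqF// subr_gt0.
apply: cvgM; first exact: cvg_cst.
apply: cvgV; first by rewrite expf_neq0.
by apply: cvgM; apply: cvgB; (exact: cvg_id || exact: cvg_cst).
Qed.


End OneVariable.

Section Mean.
Context {R : realType} {n : nat}.
Notation V := 'rV[R]_n.

Lemma is_diff_sum_delta (f : V -> R) D x v : is_diff x f (D x) ->
  D x v = \sum_j v 0 j * D x (delta_mx 0 j).
Proof.
move=> [_ h]; rewrite -h [in LHS](row_sum_delta v) linear_sum.
by apply: eq_bigr => j _; rewrite linearZ.
Qed.

(** Mean value theorem on the segment from [y] to [x]. The factor [n] appears because gradient and
    increment are both measured in the sup norm, and their pairing is a sum of [n] products. *)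
Lemma lipschitz_of_grad (f : V -> R) D M :
  C1_with setT f D -> (forall x, `|\row_j D x (delta_mx 0 j) : V| <= M) ->
  forall x y, `|f x - f y| <= n%:R * M * `|x - y|.
Proof.
move=> fD fM x y.
pose l s : V := y + s *: (x - y).
have dl s : is_diff s l ( *:%R^~ (x - y)).
  rewrite -[X in is_diff s l X]add0r.
  exact: (@is_diffD _ _ _ (cst y) (fun s : R => s *: (x - y))).
have dg s : is_derive s (1:R) (f \o l) (D (l s) (x - y)).
  have h := @is_diff_comp _ _ _ _ l _ f (D (l s)) s (dl s) (fD (l s) I).1.
  have dfl : differentiable (f \o l) s by exact: ex_diff.
  split; first exact: diff_derivable.
  by rewrite deriveE// (@diff_val _ _ _ _ _ _ _ h) /= scale1r.
have cg : {within `[0, 1], continuous (f \o l)}.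
  apply: continuous_subspaceT => s.
  apply: differentiable_continuous; apply/derivable1_diffP.
  by have [] := dg s.
have [s _] := @MVT R (f \o l) (fun s => D (l s) (x - y)) 0 1 ltr01 (fun s _ => dg s) cg.
rewrite /= /l scale1r scale0r addr0 subr0 mulr1 (addrC y) subrK => ->.
rewrite (is_diff_sum_delta _ (fD (l s) I).1).
rewrite (le_trans (ler_norm_sum _ _ _))//.
rewrite (le_trans (y := \sum_(j < n) M * `|x - y|))//.
  apply: ler_sum => j _; rewrite normrM mulrC.
  apply: ler_pM => //; last exact: coord_le_norm.
  have := coord_le_norm (\row_j D (l s) (delta_mx 0 j)) j.
  by rewrite mxE => /le_trans; apply; exact: fM.
by rewrite sumr_const card_ord -mulrA mulr_natl.
Qed.

Lemma norm_le_sum_japanese (x c : V) :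
  `|x - c| <= \sum_j japanese (c 0 j) (x 0 j).
Proof.
apply: rVnorm_le; first by apply: sumr_ge0 => j _; exact/ltW/japanese_gt0.
move=> i; rewrite !mxE (le_trans (japanese_ge _ _))//.
rewrite (bigD1 i)//= lerDl; apply: sumr_ge0 => j _; exact/ltW/japanese_gt0.
Qed.

End Mean.

(** * Barriers and the initial layer *)

Section Barrier.
Context {R : realType} {n : nat}.
Notation V := 'rV[R]_n.
Notation S := ('rV[R]_n * R)%type.
Implicit Types (H : bool -> V -> V -> R) (u : bool -> S -> R) (T k : R).

(* The two components are indexed by [bool]; [~~ i] is the other one. *)
Definition subsystem T H k u := forall i,
  viscosity_subsolution (open_strip T) (fun phi p =>
    time_deriv phi p + H i p.1 (space_grad phi p) + k * (u i p - u (~~ i) p)) (u i).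

Definition test_gradient (D : S -> S -> R) (p : S) : V := \row_j D p (dirx j).

Lemma subsystem_test T H k u i phi D p :
  subsystem T H k u -> C1_with (open_strip T) phi D -> open_strip T p ->
  touches_above (u i) phi p ->
  D p dirt + H i p.1 (test_gradient D p) + k * (u i p - u (~~ i) p) <= 0.
Proof.
move=> hu hphi sp tp.
have := hu i phi p (C1_with_C1 (@open_open_strip R n T) hphi) sp tp.
by rewrite (C1_with_time_deriv hphi sp) (C1_with_space_grad hphi sp).
Qed.

(** If some [u i - psi i] were positive, its maximum over both components and [K] would be global,
    by the ordering outside [K], and at positive time, by the initial ordering. There [psi i] is a
    test function, and maximality over the components gives [psi i - psi (~~ i) <= u i - u (~~ i)],
    so the subsolution inequality contradicts strictness. *)
Lemma strict_supersolution_bound T H k u psi D (K : set S) :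
  0 <= k -> subsystem T H k u ->
  (forall i, C1_with [set p : S | p.2 < T] (psi i) (D i)) ->
  (forall i p, open_strip T p ->
     0 < D i p dirt + H i p.1 (test_gradient (D i) p) + k * (psi i p - psi (~~ i) p)) ->
  (forall i, usc_in (initial_strip T) (u i)) ->
  (forall i x, u i (x, 0) <= psi i (x, 0)) ->
  compact K -> K `<=` initial_strip T ->
  (forall i p, initial_strip T p -> ~ K p -> u i p <= psi i p) ->
  forall i p, initial_strip T p -> u i p <= psi i p.
Proof.
move=> k0 hu dpsi strict uu init cK KT out i0 p0 Tp0.
rewrite leNgt; apply/negP => gt0.
have Kp0 : K p0 by apply: contrapT => /(out i0 _ Tp0); rewrite leNgt gt0.
have uscK i : usc_in K (fun p => u i p + - psi i p).
  apply: usc_inD; first exact: usc_in_sub (uu i).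
  apply: continuous_usc_in => p /KT /andP[_ pT]; apply: continuousN.
  apply: differentiable_continuous.
  by have [? _] := dpsi i p pT; exact: ex_diff.
have [i [p [Kp mx]]] := usc_max_compact2 cK (ex_intro _ p0 Kp0) uscK.
have pos : 0 < u i p - psi i p by apply: lt_le_trans (mx i0 _ Kp0); rewrite subr_gt0.
have gmx q : initial_strip T q -> u i q - psi i q <= u i p - psi i p.
  move=> Tq; have [Kq|nKq] := pselect (K q); first exact: mx.
  by rewrite (le_trans _ (ltW pos))// subr_le0 out.
have /andP[p0' pT] := KT _ Kp.
have pt : 0 < p.2.
  rewrite lt_neqAle p0' andbT; apply/eqP => pe; move: pos.
  by rewrite [p]surjective_pairing -pe subr_gt0 ltNge init.
have sp : open_strip T p by rewrite /open_strip/= pt pT.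
have tp : touches_above (u i) (psi i) p.
  have := open_nbhs_nbhs (conj (@open_open_strip R n T) sp).
  by apply: filterS => q /andP[q0 qT]; apply: gmx; rewrite /initial_strip/= ltW.
have dpsi' : C1_with (open_strip T) (psi i) (D i).
  by apply: C1_with_sub (dpsi i) => q /andP[].
have := subsystem_test hu dpsi' sp tp.
have := strict i p sp; have := mx (~~ i) p Kp => h1 h2 h3.
have : k * (psi i p - psi (~~ i) p) <= k * (u i p - u (~~ i) p).
  by apply: ler_wpM2l => //; lra.
lra.
Qed.

(** The mean of the two data is conserved and their difference decays like [exp (- 2 k t)]; this is
    the resulting weight of a component's own datum. For [k = 0] it is constantly 1. *)
Definition relax k t : R := (1 + expR (- (2 * k * t))) / 2.

(* The linear ODE w_i' + k (w_i - w_{1-i}) = 0 started from f i. *)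
Definition layer k (f : bool -> V -> R) i (p : S) : R :=
  relax k p.2 * f i p.1 + (1 - relax k p.2) * f (~~ i) p.1.

Lemma relax0 k : relax k 0 = 1.
Proof. by rewrite /relax mulr0 oppr0 expR0; lra. Qed.

Lemma relax_itv k t : 0 <= k -> 0 <= t -> 0 <= relax k t <= 1.
Proof.
move=> k0 t0; have e0 := expR_gt0 (- (2 * k * t)).
have : expR (- (2 * k * t)) <= 1 by rewrite expR_le1 oppr_le0 !mulr_ge0.
by rewrite /relax => e1; apply/andP; split; lra.
Qed.

Lemma C1_fun_relax k : C1_fun (relax k) (fun t => - k * (2 * relax k t - 1)).
Proof.
have e s : is_derive s (1:R) (relax k) (- k * (2 * relax k s - 1)).
  have h : is_derive s (1:R) (fun t => - (2 * k * t)) (- (2 * k)).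
    by apply: is_derive_eq; rewrite /GRing.scale/=; ring.
  have h2 := @is_derive1_comp R expR (fun t => - (2 * k * t)) s _ _ (is_derive_expR _) h.
  have h3 : is_derive s (1:R) (fun t => 2^-1 * (1 + expR (- (2 * k * t))))
      (2^-1 * (0 + expR (- (2 * k * s)) * - (2 * k))).
    by apply: is_deriveZ; apply: is_deriveD; exact: is_derive_cst.
  apply: (is_derive_ext h3) => [t|]; rewrite /relax; last by field.
  by rewrite mulrC.
split=> // s; apply: cvgM; first exact: cvg_cst.
apply: cvgB; last exact: cvg_cst; apply: cvgM; first exact: cvg_cst.
apply: differentiable_continuous; apply/derivable1_diffP.
by have [] := e s.
Qed.

(** The time derivative equals [- k (layer i - layer (~~ i))], since the two layers differ by
    [(2 relax - 1) (f i - f (~~ i))]. This is the cancellation that frees the barriers from the size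
    of [k]. *)
Lemma C1_with_layer k (f : bool -> V -> R) Df i (Omega : set S) :
  (forall i, C1_with setT (f i) (Df i)) ->
  C1_with Omega (layer k f i) (fun p v =>
    relax k p.2 * Df i p.1 v.1 + (1 - relax k p.2) * Df (~~ i) p.1 v.1
    - k * (2 * relax k p.2 - 1) * (f i p.1 - f (~~ i) p.1) * v.2).
Proof.
move=> hf.
have ra : C1_with Omega (fun p : S => relax k p.2)
    (fun p v => - k * (2 * relax k p.2 - 1) * v.2).
  apply: (@C1_with_timefun _ _ _ (relax k) (fun t => - k * (2 * relax k t - 1))) => p _.
  by have [h1 h2] := C1_fun_relax k; split; [exact: h1|exact: h2].
have h1 := C1_withM ra (C1_with_fst (Omega := Omega) (hf i)).
have h2 := C1_withM (C1_withD (C1_with_cst (Omega := Omega) 1) (C1_withN ra))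
  (C1_with_fst (Omega := Omega) (hf (~~ i))).
apply: (C1_with_ext _ _ (C1_withD h1 h2)) => // p v /=; ring.
Qed.

End Barrier.

Lemma space_time_box_compact {R : realType} {n : nat} (r a b : R) :
  compact [set p : 'rV[R]_n * R | `|p.1| <= r /\ a <= p.2 <= b].
Proof.
rewrite (_ : [set p | _] = [set x : 'rV[R]_n | `|x| <= r] `*` `[a, b]%classic).
  by apply: compact_setX; [exact: normr_cball_compact|exact: segment_compact].
by apply/seteqP; split=> -[x t] /=; rewrite in_itv.
Qed.

Section InitialLayer.
Context {R : realType} {n : nat}.
Notation V := 'rV[R]_n.
Notation S := ('rV[R]_n * R)%type.
Variables (T k M : R) (H : bool -> V -> V -> R) (u : bool -> S -> R).
Variables (f : bool -> V -> R) (Df : bool -> V -> V -> R).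
Hypotheses (k0 : 0 <= k) (hu : subsystem T H k u)
  (hf : forall i, C1_with setT (f i) (Df i))
  (fM : forall i x, `|\row_j Df i x (delta_mx 0 j) : V| <= M)
  (uu : forall i, usc_in (initial_strip T) (u i))
  (u0 : forall i x, u i (x, 0) = f i x).

(** The gradient of the layer is a convex combination of the two initial gradients, so it is bounded
    by [M] uniformly in [k]; [q] is the gradient of the penalty. *)
Lemma layer_gradient_le (i : bool) (p : S) (q : V) (s : R) : 0 <= p.2 ->
  (forall j, `|q 0 j| <= s) -> 0 <= s ->
  `|(\row_j (relax k p.2 * Df i p.1 (delta_mx 0 j) +
      (1 - relax k p.2) * Df (~~ i) p.1 (delta_mx 0 j) + q 0 j) : V)| <= M + s.
Proof.
move=> p0 qs s0; have /andP[r0 r1] := relax_itv k0 p0.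
have M0 : 0 <= M by exact: le_trans (fM i p.1).
apply: rVnorm_le => [|j]; first by rewrite addr_ge0.
have g l : `|Df l p.1 (delta_mx 0 j)| <= M.
  have := coord_le_norm (\row_j Df l p.1 (delta_mx 0 j)) j.
  by rewrite mxE => /le_trans; apply.
rewrite mxE (le_trans (ler_normD _ _))// lerD//.
rewrite (le_trans (ler_normD _ _))//. rewrite (normrM (relax _ _)) (normrM (1 - _)).
rewrite (ger0_norm r0) (@ger0_norm _ (1 - _)) ?subr_ge0//.
have h1 := ler_wpM2l r0 (g i).
have h2 : (1 - relax k p.2) * `|Df (~~ i) p.1 (delta_mx 0 j)| <= (1 - relax k p.2) * M.
  by apply: ler_wpM2l; rewrite ?subr_ge0.
by rewrite (le_trans (lerD h1 h2))//; lra.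
Qed.

(** The assumed growth rate [B] is below the penalty slope [s], so the penalty wins at infinity and
    the comparison takes place on a compact set. The Hamiltonian only meets gradients of size at
    most [M + s], where the drift [C] dominates [- H]. *)
Lemma layer_bound_step A B s C : 0 <= C -> B < s -> 0 <= B ->
  (forall i p, initial_strip T p -> u i p <= layer k f i p + A + B * `|p.1|) ->
  (forall i xi q, `|q| <= M + s -> - C <= H i xi q) ->
  forall i p, initial_strip T p -> u i p <= layer k f i p + C * p.2 + s * n%:R.
Proof.
move=> C0 Bs B0 growth HC i0 [x0 t0] Tp0; have s0 : 0 < s by lra.
have /andP[/= t00 t0T] := Tp0.
(* The penalty is centred at the point [x0] under examination, where each bracket equals 1: it costs
   exactly [s n]. The barrier costs an arbitrarily small amount. *)
suff key e : 0 < e -> forall i p, initial_strip T p ->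
  u i p <= layer k f i p + (C * p.2 + (s * \sum_j japanese (x0 0 j) (p.1 0 j)
           + e / (T - p.2))).
  apply/ler_addgt0Pr => e e0.
  have Tt : 0 < T - t0 by rewrite subr_gt0.
  have /= := key (e * (T - t0)) (mulr_gt0 e0 Tt) i0 _ Tp0.
  rewrite mulfK ?gt_eqF// => h; apply: le_trans h _.
  rewrite (eq_bigr (fun=> 1)); last by move=> j _; rewrite japanese_center.
  by rewrite sumr_const card_ord; lra.
move=> e0 {i0}.
pose E (p v : S) := C * v.2 + (s * (\sum_j japanese' (x0 0 j) (p.1 0 j) * v.1 0 j)
           + e / (T - p.2) ^+ 2 * v.2).
have dE : C1_with [set p : S | p.2 < T] (fun p => C * p.2 +
    (s * \sum_j japanese (x0 0 j) (p.1 0 j) + e / (T - p.2))) E.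
  apply: C1_withD; first exact: (@C1_withZ _ _ _ C snd _ (C1_with_time (Omega:=_))).
  apply: C1_withD.
    apply: (@C1_withZ _ _ _ s (fun p : S => \sum_j japanese (x0 0 j) (p.1 0 j))).
    apply: (@C1_with_sep _ _ _ (fun j => japanese (x0 0 j)) (fun j => japanese' (x0 0 j))) => j.
    exact: C1_fun_japanese.
  apply: (@C1_with_timefun _ _ _ (fun t => e / (T - t)) (fun t => e / (T - t) ^+ 2)).
  by move=> p /= pT; split; [exact: barrier_derive|exact: barrier_derive_continuous].
(* Beyond [rho] the slope surplus [s - B] lets the penalty exceed [A + B |x|]; within [tau] of [T]
   the barrier exceeds [A' + 1]. The term [s |x0|] in [A'] pays for the centring of the penalty. *)
pose A' := `|A| + s * `|x0|.
pose rho := A' / (s - B); pose tau := e / (A' + 1).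
have A'0 : 0 <= A' by rewrite addr_ge0// mulr_ge0// ltW.
have tau0 : 0 < tau by rewrite divr_gt0// ltr_pwDr.
pose K := [set p : S | `|p.1| <= rho /\ 0 <= p.2 <= T - tau].
have cK : compact K by exact: space_time_box_compact.
have J (p : V) : s * (`|p| - `|x0|) <= s * \sum_j japanese (x0 0 j) (p 0 j).
  apply: ler_wpM2l; first exact: ltW.
  apply: le_trans (norm_le_sum_japanese p x0).
  exact: lerB_dist.
apply: (strict_supersolution_bound k0 hu (fun i => C1_withD (C1_with_layer k i hf) dE) _ uu _ cK).
- move=> i p /andP[p0 pT]; rewrite /E /dirt /= !mulr1.
  have z l : Df l p.1 0 = 0.
    by rewrite (is_diff_sum_delta _ (hf l I).1) big1// => j _; rewrite mxE mul0r.
  rewrite !z !mulr0 sum_zero mulr0 !add0r ?addr0 ?negbK.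
  set q := test_gradient _ _.
  have qM : `|q| <= M + s.
    pose q0 : V := \row_j (s * japanese' (x0 0 j) (p.1 0 j)).
    rewrite (_ : q = \row_j (relax k p.2 * Df i p.1 (delta_mx 0 j) +
      (1 - relax k p.2) * Df (~~ i) p.1 (delta_mx 0 j) + q0 0 j)).
      apply: layer_gradient_le => //; [exact: ltW| |exact: ltW].
      move=> j; rewrite mxE normrM gtr0_norm// -[leRHS]mulr1.
      by apply: ler_wpM2l; [exact: ltW|exact: japanese'_le1].
    by apply/rowP => j; rewrite !mxE /= !mulr0 sum_delta; lra.
  have := HC i p.1 q qM.
  have : 0 < e / (T - p.2) ^+ 2 by rewrite divr_gt0// exprn_gt0// subr_gt0.
  rewrite /layer negbK.
  set x := f i _; set y := f (~~ i) _; set a := relax _ _.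
  set X := e / _; set Y := C * _; set Z := s * _; set W := e / _; set HH := H _ _ _.
  (* The added terms agree for both components and drop out of the coupling; the remainder cancels
     the time derivative of the layer, leaving [C + e / (T - t)^2 + H > 0]. *)
  have -> : k * (a * x + (1 - a) * y + (Y + (Z + W)) - (a * y + (1 - a) * x + (Y + (Z + W))))
     = k * (2 * a - 1) * (x - y) by ring.
  by move=> X0 HH0; lra.
- move=> i x; rewrite u0 /layer /= relax0 subrr mul0r addr0 mul1r mulr0 add0r subr0.
  rewrite lerDl addr_ge0//.
    apply: mulr_ge0; [exact: ltW|apply: sumr_ge0 => j _; exact/ltW/japanese_gt0].
  by rewrite divr_ge0// ltW//; exact: le_lt_trans t0T.
- by move=> p [_ /andP[p0 pT]]; rewrite /initial_strip/= p0 (le_lt_trans pT)// ltrBlDr ltrDl.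
move=> i p Tp nKp; have /andP[p0 pT] := Tp.
apply: le_trans (growth i p Tp) _.
have Ct : 0 <= C * p.2 by exact: mulr_ge0.
have eT : 0 <= e / (T - p.2) by rewrite divr_ge0 ?ltW// subr_gt0.
have := J p.1; have AA := ler_norm A.
rewrite -addrA lerD2l.
have [xr|xr] := lerP `|p.1| rho; last first.
  have : A' < `|p.1| * (s - B) by rewrite -ltr_pdivrMr// subr_gt0.
  rewrite /A'; lra.
have tt : T - tau < p.2.
  rewrite ltNge; apply/negP => h; apply: nKp; split=> //.
  by rewrite p0.
have : A' + 1 <= e / (T - p.2).
  rewrite ler_pdivlMr ?subr_gt0// mulrC -ler_pdivlMr; first by rewrite -/tau; lra.
  by rewrite ltr_pwDr.
have : B * `|p.1| <= s * `|p.1| by apply: ler_wpM2r => //; exact: ltW.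
rewrite /A'; lra.
Qed.

Lemma f_growth i x : `|f i x| <= `|f i 0| + n%:R * M * `|x|.
Proof.
have := lipschitz_of_grad (hf i) (fM i) x 0; rewrite subr0.
by have := ler_normD (f i x - f i 0) (f i 0); rewrite subrK; lra.
Qed.

(* A first pass with a slope exceeding the growth rate of [u] makes [u - layer]
   bounded; any small slope is then steep enough, and the constant no longer
   depends on the growth rate. *)
Lemma layer_bound C : 0 <= C -> (forall i, linear_growth T (u i)) ->
  (forall i, locally_bounded_in_p (H i)) ->
  (forall i xi q, `|q| <= M + 1 -> - C <= H i xi q) ->
  forall i p, initial_strip T p -> u i p <= layer k f i p + C * p.2.
Proof.
move=> C0 gu Hb HC i0 p0 Tp0.
have /andP[p00 pT0] := Tp0; have T0 : 0 < T by exact: le_lt_trans pT0.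
have M0 : 0 <= M by exact: le_trans (fM true 0).
have [K1 h1] := gu true; have [K2 h2] := gu false.
(* [|K1|] and [|K2|] bound the growth of the two components and [n M] that of the layers; the first
   pass uses the slope [B + 1]. *)
pose B := `|K1| + `|K2| + n%:R * M.
pose A := B + `|f true 0| + `|f false 0|.
have nM : 0 <= n%:R * M by exact: mulr_ge0.
have B0 : 0 <= B by rewrite !addr_ge0.
have growth i p : initial_strip T p -> u i p <= layer k f i p + A + B * `|p.1|.
  move=> Tp; have /andP[pp pT] := Tp; have /andP[r0 r1] := relax_itv k0 pp.
  have uK : u i p <= (`|K1| + `|K2|) * (1 + `|p.1|).
    have := ler_norm (u i p); have := ler_norm K1; have := ler_norm K2.
    have N1 := normr_ge0 K1; have N2 := normr_ge0 K2; have N3 := normr_ge0 p.1.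
    case: i; [have := h1 p Tp|have := h2 p Tp] => h e2 e1 e3; nra.
  have ly : - (`|f true 0| + `|f false 0| + n%:R * M * `|p.1|) <= layer k f i p.
    have := f_growth true p.1; have := f_growth false p.1.
    have N1 := normr_ge0 (f true 0); have N2 := normr_ge0 (f false 0).
    rewrite !ler_norml => /andP[a1 a2] /andP[a3 a4].
    set G := n%:R * M * `|p.1| in a1 a2 a3 a4 *.
    by rewrite /layer; case: i {uK} => /=; nra.
  rewrite /A /B; lra.
have [C1 HC1] := Hb true (M + (B + 1)).
have [C2 HC2] := Hb false (M + (B + 1)).
have HC' i xi q : `|q| <= M + (B + 1) -> - (`|C1| + `|C2|) <= H i xi q.
  move=> qM; have N1 := ler_norm C1; have N2 := ler_norm C2.
  have N3 := normr_ge0 C1; have N4 := normr_ge0 C2.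
  by case: i; [have := HC1 xi q qM|have := HC2 xi q qM];
    rewrite ler_norml => /andP[]; lra.
have C12 : 0 <= `|C1| + `|C2| by exact: addr_ge0.
have BB : B < B + 1 by rewrite ltrDl.
have bdd := layer_bound_step C12 BB B0 growth HC'.
pose A2 := (`|C1| + `|C2|) * T + (B + 1) * n%:R.
have growth2 i p : initial_strip T p -> u i p <= layer k f i p + A2 + 0 * `|p.1|.
  move=> Tp; have /andP[pp pT] := Tp; have := bdd i p Tp.
  have := ler_wpM2l C12 (ltW pT); rewrite /A2; lra.
apply/ler_addgt0Pr => e e0.
(* [s <= 1] keeps the gradients within [M + 1], where [C] is valid, and [s n <= e] makes the cost of
   the penalty negligible; [n.+1] covers [n = 0]. *)
pose s := Num.min 1 (e / n.+1%:R).
have s0 : 0 < s by rewrite lt_min ltr01 divr_gt0.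
have s1 : s <= 1 by rewrite ge_min lexx.
have HC2' i xi q : `|q| <= M + s -> - C <= H i xi q.
  by move=> qM; apply: HC; rewrite (le_trans qM)// lerD2l.
apply: le_trans (layer_bound_step C0 s0 (lexx 0) growth2 HC2' i0 Tp0) _.
rewrite lerD2l; apply: (@le_trans _ _ (e / n.+1%:R * n%:R)).
  by apply: ler_wpM2r => //; rewrite ge_min lexx orbT.
rewrite mulrAC ler_pdivrMr// ler_wpM2l ?(ltW e0)//.
by rewrite ler_nat.
Qed.

End InitialLayer.

(** * Comparison for the effective equation *)

Lemma continuous_sum {R : realType} (X : topologicalType) n (F : 'I_n -> X -> R) x :
  (forall j, {for x, continuous (F j)}) ->
  {for x, continuous (fun z => \sum_j F j z)}.
Proof.
elim: n F => [|n IH] F h.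
  rewrite (_ : (fun z => _) = cst 0); first exact: cst_continuous.
  by apply/funext => z; rewrite big_ord0.
rewrite (_ : (fun z => _) = fun z => F ord0 z + \sum_j F (lift ord0 j) z).
  by apply: continuousD; [exact: h|apply: IH => j; exact: h].
by apply/funext => z; rewrite big_ord_recl.
Qed.

Section Comparison.
Context {R : realType} {n : nat}.
Notation V := 'rV[R]_n.
Notation S := ('rV[R]_n * R)%type.

Lemma norm_sq_le_sum (x : V) : `|x| ^+ 2 <= \sum_j (x 0 j) ^+ 2.
Proof.
have h : 0 <= \sum_j (x 0 j) ^+ 2 by apply: sumr_ge0 => j _; exact: sqr_ge0.
suff : `|x| <= Num.sqrt (\sum_j (x 0 j) ^+ 2).
  by move=> le; rewrite -[leRHS]sqr_sqrtr// lerXn2r// nnegrE.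
apply: rVnorm_le => [|i]; first exact: sqrtr_ge0.
rewrite -sqrtr_sqr ler_wsqrtr// (bigD1 i)//= lerDl.
by apply: sumr_ge0 => j _; exact: sqr_ge0.
Qed.

Definition loc_unif_continuous (G : V -> R) := forall r e, 0 < e ->
  exists2 d, 0 < d & forall p p', `|p| <= r -> `|p - p'| <= d -> `|G p - G p'| < e.

Lemma C1_with_quad (m : R) (y : V) (s : R) (Omega : set S) :
  C1_with Omega (fun p => \sum_j m * (p.1 0 j - y 0 j) ^+ 2 + m * (p.2 - s) ^+ 2)
   (fun p v => \sum_j m * (2 * (p.1 0 j - y 0 j)) * v.1 0 j + m * (2 * (p.2 - s)) * v.2).
Proof.
apply: C1_withD.
  apply: (@C1_with_sep _ _ _ (fun j t => m * (t - y 0 j) ^+ 2) (fun j t => m * (2 * (t - y 0 j)))).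
  by move=> j; exact: C1_fun_sqr.
apply: (@C1_with_timefun _ _ _ (fun t => m * (t - s) ^+ 2) (fun t => m * (2 * (t - s)))).
by move=> p _; have [h1 h2] := C1_fun_sqr s m; split; [exact: h1|exact: h2].
Qed.

(** Completing the square: for large [m] the penalty [m a^2] beats linear growth up to an
    arbitrarily small error, which is the price of doubling the variables. *)
Lemma linear_minus_square (L a m : R) : 0 < m -> L * a - m * a ^+ 2 <= L ^+ 2 / (4 * m).
Proof.
move=> m0; rewrite ler_pdivlMr ?mulr_gt0//.
have -> : (L * a - m * a ^+ 2) * (4 * m) = L ^+ 2 - (L - 2 * m * a) ^+ 2 by ring.
by rewrite lerBlDr lerDl sqr_ge0.
Qed.

(* Centring the doubling penalty at the shift (p.1 - q.1, p.2 - q.2) gives the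
   comparison principle (p = q) and the Lipschitz estimate at once.  The linear
   bounds on U and Lo keep the gradient of the penalty bounded, so that local
   uniform continuity of Hbar suffices. *)
Lemma comparison (T L C : R) (Hbar : V -> R) (g : V -> R) (U Lo : S -> R) :
  loc_unif_continuous Hbar -> 0 <= L -> 0 <= C ->
  (forall x y, `|g x - g y| <= L * `|x - y|) ->
  usc_in (open_strip T) U -> usc_in (open_strip T) (fun p => - Lo p) ->
  (forall p, open_strip T p -> U p <= g p.1 + C * p.2) ->
  (forall p, open_strip T p -> g p.1 - C * p.2 <= Lo p) ->
  viscosity_subsolution (open_strip T)
    (fun phi p => time_deriv phi p + Hbar (space_grad phi p)) U ->
  viscosity_supersolution (open_strip T)
    (fun phi p => time_deriv phi p + Hbar (space_grad phi p)) Lo ->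
  forall p q, open_strip T p -> open_strip T q ->
    U p - Lo q <= L * `|p.1 - q.1| + C * `|p.2 - q.2|.
Proof.
move=> cH L0 C0 gL uU uL Ug Lg sub sup p0 q0 sp0 sq0.
pose h := p0.1 - q0.1; pose ta := p0.2 - q0.2.
pose K0 := L * `|h| + C * `|ta|.
have Lh0 : 0 <= L * `|h| by exact: mulr_ge0.
have Ct0 : 0 <= C * `|ta| by exact: mulr_ge0.
have K00 : 0 <= K0 by exact: addr_ge0.
rewrite leNgt; apply/negP; rewrite -/h -/ta -/K0 -subr_gt0; set d0 := U p0 - Lo q0 - K0 => d00.
have /andP[t0 tT] := sp0; have T0 : 0 < T by exact: lt_trans tT.
have /andP[s0 sT] := sq0.
have Tt : 0 < Num.min (T - p0.2) (T - q0.2) by rewrite lt_min !subr_gt0 tT.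
(* Error budget at [(p0, q0)]: each barrier costs at most [d0 / 8] and the localization at most
   [d0 / 4], while the doubling penalty vanishes there by its centring; so [Phi] is at least
   [K0 + d0 / 2]. *)
pose eta := d0 * Num.min (T - p0.2) (T - q0.2) / 8.
have eta0 : 0 < eta by rewrite divr_gt0// mulr_gt0.
pose m := (L ^+ 2 + C ^+ 2 + 1) / d0 * 2.
have LC : 0 < L ^+ 2 + C ^+ 2 + 1 by rewrite ltr_wpDl// addr_ge0// sqr_ge0.
have m0 : 0 < m by rewrite mulr_gt0// divr_gt0.
have lay : L ^+ 2 / (4 * m) + C ^+ 2 / (4 * m) < d0 / 8.
  have m4 : 0 < 4 * m by exact: mulr_gt0.
  rewrite -mulrDl ltr_pdivrMr// /m.
  have -> : d0 / 8 * (4 * ((L ^+ 2 + C ^+ 2 + 1) / d0 * 2)) = L ^+ 2 + C ^+ 2 + 1.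
    by field; rewrite gt_eqF.
  by rewrite ltrDl.
(* Bound for [|x - y - h|] wherever [Phi >= 0], which makes the penalty gradient at most [2 m ab].
   It does not involve [de], so the modulus [dl] of [Hbar] can be fixed before the localization
   weight [de], which must not exceed it. *)
pose ab := 1 + (L + 2 * C * T + L * `|h|) / m.
have CT0 : 0 <= C * T by rewrite mulr_ge0// ltW.
have N0 : 0 <= L + 2 * C * T + L * `|h| by lra.
have ab0 : 0 < ab by rewrite ltr_pwDl// divr_ge0 ?(ltW m0).
have [dl dl0 hdl] := cH (2 * m * ab) (eta / T ^+ 2) (divr_gt0 eta0 (exprn_gt0 2 T0)).
pose J0 := \sum_j japanese 0 (p0.1 0 j).
have J00 : 0 <= J0 by apply: sumr_ge0 => j _; exact/ltW/japanese_gt0.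
pose de := Num.min dl (d0 / 4 / (J0 + 1)).
have de0 : 0 < de by rewrite lt_min dl0 divr_gt0 ?divr_gt0// ltr_pwDr.
have deJ : de * J0 <= d0 / 4.
  apply: (@le_trans _ _ (d0 / 4 / (J0 + 1) * J0)).
    by apply: ler_wpM2r => //; rewrite ge_min lexx orbT.
  by rewrite mulrAC ler_pdivrMr ?ltr_pwDr// ler_wpM2l ?lerDl// divr_ge0// ltW.
pose Phi (z : S * S) := U z.1 + - Lo z.2 +
  - (\sum_j m * (z.1.1 0 j - (z.2.1 + h) 0 j) ^+ 2 + m * (z.1.2 - (z.2.2 + ta)) ^+ 2
     + de * \sum_j japanese 0 (z.1.1 0 j) + eta / (T - z.1.2) + eta / (T - z.2.2)).
have hq : q0.1 + h = p0.1 by rewrite /h addrC subrK.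
have tq : q0.2 + ta = p0.2 by rewrite /ta addrC subrK.
have Phi0 : d0 / 2 + K0 <= Phi (p0, q0).
  rewrite /Phi /= hq tq big1 ?subrr ?expr0n ?mulr0; last by move=> j _; rewrite subrr expr0n mulr0.
  have e8 t : t < T -> Num.min (T - p0.2) (T - q0.2) <= T - t -> eta / (T - t) <= d0 / 8.
    move=> tT' le; rewrite ler_pdivrMr ?subr_gt0// /eta mulrAC.
    by apply: ler_wpM2l => //; rewrite divr_ge0// ltW.
  have ep : eta / (T - p0.2) <= d0 / 8 by apply: e8 => //; rewrite ge_min lexx.
  have eq : eta / (T - q0.2) <= d0 / 8 by apply: e8 => //; rewrite ge_min lexx orbT.
  move: deJ ep eq; rewrite -/J0 /d0 !add0r; clear => *; lra.
have dedl : de <= dl by rewrite ge_min lexx.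
have K0E : K0 = L * `|h| + C * `|ta| by [].
have UL (p q : S) : open_strip T p -> open_strip T q ->
    U p - Lo q <= L * `|p.1 - (q.1 + h)| + L * `|h| + C * (p.2 + q.2).
  move=> sp sq; have := Ug p sp; have := Lg q sq; have := gL p.1 q.1.
  have tri : `|p.1 - q.1| <= `|p.1 - (q.1 + h)| + `|h|.
    by apply: le_trans (ler_normD _ _); rewrite opprD (addrA p.1) subrK.
  have := ler_wpM2l L0 tri.
  by rewrite ler_norml => + /andP[_]; clear => *; lra.
have sumsq (p q : S) : m * `|p.1 - (q.1 + h)| ^+ 2 <= \sum_j m * (p.1 0 j - (q.1 + h) 0 j) ^+ 2.
  rewrite -mulr_sumr; apply: ler_wpM2l; first exact: ltW.
  apply: le_trans (norm_sq_le_sum _) _.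
  by apply: ler_sum => j _; rewrite !mxE.
have etaT t : t < T -> 0 < eta / (T - t) by move=> ?; rewrite divr_gt0// subr_gt0.
(* Upper bound for the terms of [Phi] other than localization and barriers; hence [Phi >= 0] forces
   [|x| <= Bx / de] and keeps both times away from [T]. *)
pose Bx := L ^+ 2 / (4 * m) + 2 * C * T + L * `|h|.
have Bx0 : 0 <= Bx.
  have : 0 <= L ^+ 2 / (4 * m) by rewrite divr_ge0 ?sqr_ge0// mulr_ge0// ltW.
  have : 0 <= C * T by rewrite mulr_ge0// ltW.
  rewrite /Bx; lra.
have PhiB (p q : S) : open_strip T p -> open_strip T q ->
    Phi (p, q) <= L * `|h| + L * `|p.1 - (q.1 + h)| - m * `|p.1 - (q.1 + h)| ^+ 2
      + (C * (p.2 + q.2) - m * (p.2 - (q.2 + ta)) ^+ 2)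
      - de * `|p.1| - eta / (T - p.2) - eta / (T - q.2).
  move=> sp sq; have := UL p q sp sq; have := sumsq p q; rewrite /Phi /=.
  have : de * `|p.1| <= de * \sum_j japanese 0 (p.1 0 j).
    apply: ler_wpM2l; first exact: ltW.
    have := norm_le_sum_japanese p.1 0; rewrite subr0 => /le_trans; apply.
    by apply: ler_sum => j _; rewrite mxE.
  lra.
have PhiBx (p q : S) : open_strip T p -> open_strip T q ->
    Phi (p, q) <= Bx - de * `|p.1| - eta / (T - p.2) - eta / (T - q.2).
  move=> sp sq; have := PhiB p q sp sq.
  have := linear_minus_square L `|p.1 - (q.1 + h)| m0.
  have /andP[_ pT] := sp; have /andP[_ qT] := sq.
  have : C * (p.2 + q.2) <= C * (T + T) by apply: ler_wpM2l => //; exact: lerD (ltW pT) (ltW qT).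
  have : 0 <= m * (p.2 - (q.2 + ta)) ^+ 2 by rewrite mulr_ge0 ?sqr_ge0// ltW.
  by rewrite /Bx; clear => *; lra.
have Phia (p q : S) : open_strip T p -> open_strip T q -> 0 <= Phi (p, q) ->
    `|p.1 - (q.1 + h)| <= ab.
  move=> sp sq Pp; rewrite leNgt; apply/negP => aab.
  set a := `|p.1 - (q.1 + h)| in aab *.
  have a1 : 1 < a by apply: le_lt_trans aab; rewrite lerDl divr_ge0 ?(ltW m0).
  have := PhiB p q sp sq; rewrite -/a.
  have /andP[_ pT] := sp; have /andP[_ qT] := sq.
  have : C * (p.2 + q.2) <= C * (T + T) by apply: ler_wpM2l => //; exact: lerD (ltW pT) (ltW qT).
  have h1 : 0 <= m * (p.2 - (q.2 + ta)) ^+ 2 by rewrite mulr_ge0 ?sqr_ge0// ltW.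
  have h2 := etaT _ pT; have h3 := etaT _ qT.
  have h4 : 0 <= de * `|p.1| by rewrite mulr_ge0// ltW.
  have h5 : L + 2 * C * T + L * `|h| < m * (a - 1).
    have : (L + 2 * C * T + L * `|h|) / m < a - 1 by rewrite ltrBrDl.
    by rewrite ltr_pdivrMr// (mulrC _ m).
  have h6 : 0 <= C * T by rewrite mulr_ge0// ltW.
  have h7 : (L + 2 * C * T + L * `|h|) * a <= m * (a - 1) * a by rewrite ler_wpM2r ?(ltW h5)// ltW// (lt_trans ltr01).
  have h8 : 2 * C * T + L * `|h| <= (2 * C * T + L * `|h|) * a by rewrite -[leLHS]mulr1 ler_wpM2l ?(ltW a1)// addr_ge0// -mulrA mulr_ge0.
  have h9 : 0 < m * a by rewrite mulr_gt0// (lt_trans ltr01).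
  move: Pp h1 h2 h3 h4 h6 h7 h8 h9; clear => *; lra.
(* [U] and [Lo] are controlled in the open strip only, so time is cut at [tau] instead of 0; on that
   slice the bounds [g + C t] and [g - C t] cost [2 C tau], at most [d0 / 8]. *)
pose tau := Num.min (Num.min (p0.2 / 2) (q0.2 / 2)) (d0 / 16 / (C + 1)).
have C10 : 0 < C + 1 by rewrite ltr_wpDl.
have tau0 : 0 < tau by rewrite !lt_min !divr_gt0.
have tau1 : tau <= p0.2 / 2 by rewrite !ge_min lexx.
have tau2 : tau <= q0.2 / 2 by rewrite !ge_min lexx orbT.
have tau3 : 2 * C * tau <= d0 / 8.
  have : tau <= d0 / 16 / (C + 1) by rewrite !ge_min lexx !orbT.
  rewrite ler_pdivlMr// => hh; have : C * tau <= tau * (C + 1) by rewrite mulrC ler_wpM2l ?(ltW tau0)// lerDl.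
  by move: hh; clear => *; lra.
pose tau' := eta / (Bx + 1).
have Bx1 : 0 < Bx + 1 by rewrite ltr_wpDl.
have tau'0 : 0 < tau' by rewrite divr_gt0.
pose rho := Bx / de.
pose A := [set p : S | `|p.1| <= rho + ab + `|h| /\ tau <= p.2 <= T - tau'].
pose K := A `*` A.
have cK : compact K by apply: compact_setX; exact: space_time_box_compact.
have AT p : A p -> open_strip T p.
  move=> [_ /andP[h1 h2]]; rewrite /open_strip/= (lt_le_trans tau0 h1).
  by rewrite (le_lt_trans h2)// ltrBlDr ltrDl.
have inK p q : tau <= p.2 < T -> tau <= q.2 < T -> 0 <= Phi (p, q) -> K (p, q).
  move=> /andP[p1 p2] /andP[q1 q2] P0.
  have sp : open_strip T p by rewrite /open_strip/= p2 (lt_le_trans tau0).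
  have sq : open_strip T q by rewrite /open_strip/= q2 (lt_le_trans tau0).
  have h1 := PhiBx p q sp sq; have h2 := etaT _ p2; have h3 := etaT _ q2.
  have h4 : 0 <= de * `|p.1| by rewrite mulr_ge0// ltW.
  have tt t : t < T -> eta / (T - t) <= Bx -> t <= T - tau'.
    move=> tT' hh; rewrite leNgt; apply/negP => h'.
    have : Bx + 1 < eta / (T - t).
      rewrite ltr_pdivlMr ?subr_gt0// mulrC -ltr_pdivlMr// -/tau'.
      by move: h'; clear => *; lra.
    by move: hh; clear => *; lra.
  have prho : `|p.1| <= rho by rewrite ler_pdivlMr// mulrC; move: P0 h1 h2 h3; clear => *; lra.
  split; split=> /=.
  - by have := normr_ge0 h; move: prho ab0; clear => *; lra.
  - by rewrite p1 tt//; move: P0 h1 h3 h4; clear => *; lra.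
  - have := Phia p q sp sq P0; have := ler_normD (q.1 + h - p.1) p.1.
    have := ler_normB (q.1 + h) h; rewrite addrK subrK (distrC (q.1 + h)).
    by move: prho; clear => *; lra.
  - by rewrite q1 tt//; move: P0 h1 h2 h4; clear => *; lra.
have contx (z : S * S) j : {for z, continuous (fun z : S * S => z.1.1 0 j)}.
  apply: (@continuous_comp _ _ _ (fun z : S * S => z.1.1) (fun y : V => y 0 j)).
    apply: (@continuous_comp _ _ _ (fun z : S * S => z.1) fst); exact: cvg_fst.
  exact: coord_continuous.
have conty (z : S * S) j : {for z, continuous (fun z : S * S => z.2.1 0 j)}.
  apply: (@continuous_comp _ _ _ (fun z : S * S => z.2.1) (fun y : V => y 0 j)).
    apply: (@continuous_comp _ _ _ (fun z : S * S => z.2) fst); [exact: cvg_snd|exact: cvg_fst].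
  exact: coord_continuous.
have contt (z : S * S) : {for z, continuous (fun z : S * S => z.1.2)}.
  by apply: (@continuous_comp _ _ _ (fun z : S * S => z.1) snd); [exact: cvg_fst|exact: cvg_snd].
have conts (z : S * S) : {for z, continuous (fun z : S * S => z.2.2)}.
  by apply: (@continuous_comp _ _ _ (fun z : S * S => z.2) snd); exact: cvg_snd.
have uPhi : usc_in K Phi.
  apply: usc_inD; first apply: usc_inD.
  - by apply: (usc_in_comp (A := open_strip T)) uU => [z [+ _]|z _]; [exact: AT|exact: cvg_fst].
  - apply: (@usc_in_comp _ _ _ (open_strip T) _ (fun p => - Lo p) snd) uL => [z [_ +]|z _]; [exact: AT|exact: cvg_snd].
  - apply: continuous_usc_in => z [/AT/andP[_ z1] /AT/andP[_ z2]].
    apply: continuousN; apply: continuousD; first apply: continuousD.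
    + apply: continuousD; first apply: continuousD.
      * apply: continuous_sum => j; apply: continuousM; first exact: cst_continuous.
        have conty' (z' : S * S) j' : {for z', continuous (fun z : S * S => (z.2.1 + h) 0 j')}.
          rewrite (_ : (fun z => _) = fun z : S * S => z.2.1 0 j' + h 0 j').
            by apply: continuousD; [exact: conty|exact: cst_continuous].
          by apply/funext => z''; rewrite mxE.
        by apply: continuousM; apply: continuousB; (exact: contx || exact: conty').
      * apply: continuousM; first exact: cst_continuous.
        have conts' : {for z, continuous (fun z : S * S => z.2.2 + ta)}.
          by apply: continuousD; [exact: conts|exact: cst_continuous].
        by apply: continuousM; apply: continuousB; (exact: contt || exact: conts').
      * apply: continuousM; first exact: cst_continuous.
        apply: continuous_sum => j.
        apply: (@continuous_comp _ _ _ (fun z : S * S => z.1.1 0 j) (japanese 0)); first exact: contx.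
        apply: differentiable_continuous; apply/derivable1_diffP.
        by have [] := (C1_fun_japanese (0:R)).1 (z.1.1 0 j).
    + apply: continuousM; first exact: cst_continuous.
      apply: continuousV; first by rewrite gt_eqF// subr_gt0.
      by apply: continuousB; [exact: cst_continuous|exact: contt].
    + apply: continuousM; first exact: cst_continuous.
      apply: continuousV; first by rewrite gt_eqF// subr_gt0.
      by apply: continuousB; [exact: cst_continuous|exact: conts].
have Kp0 : K (p0, q0) by apply: inK; [move: t0 tT tau1|move: s0 sT tau2|apply: le_trans Phi0; move: d00 K00]; clear => *; lra.
have [[p q] Kpq mx] := usc_max_compact cK (ex_intro _ _ Kp0) uPhi.
have hpq : d0 / 2 + K0 <= Phi (p, q) by exact: le_trans Phi0 (mx _ Kp0).
have [/= Ap Aq] := Kpq.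
have sp := AT p Ap; have sq := AT q Aq.
have /andP[pp pT] := sp; have /andP[qq qT] := sq.
have B1 := PhiB p q sp sq.
have B2 := linear_minus_square L `|p.1 - (q.1 + h)| m0.
have B3 : 0 <= de * `|p.1| by rewrite mulr_ge0// ltW.
have B4 := etaT _ pT; have B5 := etaT _ qT.
have Cta : - (C * `|ta|) <= C * ta <= C * `|ta|.
  by rewrite -mulrN !ler_wpM2l// ?ler_norm// lerNl -normrN ler_norm.
have /andP[Cta1 Cta2] := Cta.
(* On the slice, the sum of the two times multiplied by [C] is [2 C tau], plus [C] times the offset
   from the centre of the penalty, minus [C ta]. The square absorbs the offset, and [Phi] would fall
   below [K0 + d0 / 2]. *)
have ptau : tau < p.2.
  have [_ /andP[h' _]] := Ap; rewrite lt_neqAle h' andbT; apply/eqP => e.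
  have := linear_minus_square C (q.2 + ta - p.2) m0.
  have -> : (q.2 + ta - p.2) ^+ 2 = (p.2 - (q.2 + ta)) ^+ 2 by ring.
  have e2 : C * tau = C * p.2 by rewrite e.
  move: hpq; rewrite K0E; move: B1 B2 B3 B4 B5 lay e2 tau3 Cta1 Cta2 d00; clear => *; lra.
have qtau : tau < q.2.
  have [_ /andP[h' _]] := Aq; rewrite lt_neqAle h' andbT; apply/eqP => e.
  have := linear_minus_square C (p.2 - (q.2 + ta)) m0.
  have e2 : C * tau = C * q.2 by rewrite e.
  move: hpq; rewrite K0E; move: B1 B2 B3 B4 B5 lay e2 tau3 Cta1 Cta2 d00; clear => *; lra.
have Ppq : 0 <= Phi (p, q) by apply: le_trans hpq; rewrite addr_ge0// divr_ge0// ltW.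
have gmx p' q' : tau <= p'.2 < T -> tau <= q'.2 < T -> Phi (p', q') <= Phi (p, q).
  move=> h1 h2; have [P0|/ltW P0] := leP 0 (Phi (p', q')).
    by apply: mx; exact: inK.
  exact: le_trans P0 Ppq.
have slab (r : S) : tau < r.2 < T -> \forall r' \near r, tau <= r'.2 < T.
  move=> hh; have : open_nbhs r [set r : S | tau < r.2 < T].
    split=> //; rewrite (_ : [set r | _] = snd @^-1` (`]tau, T[%classic : set R)).
      by apply: open_comp; [move=> z _; exact: cvg_snd|exact: interval_open].
    by apply/seteqP; split => z /=; rewrite in_itv.
  by move=> /open_nbhs_nbhs; apply: filterS => z /andP[/ltW -> ->].
have pslab : tau < p.2 < T by rewrite ptau.
have qslab : tau < q.2 < T by rewrite qtau.
pose phi (r : S) := (\sum_j m * (r.1 0 j - (q.1 + h) 0 j) ^+ 2 + m * (r.2 - (q.2 + ta)) ^+ 2) +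
  (de * (\sum_j japanese 0 (r.1 0 j)) + eta / (T - r.2)).
have bar : C1_with (open_strip T : set S) (fun r => eta / (T - r.2))
    (fun r v => eta / (T - r.2) ^+ 2 * v.2).
  apply: (@C1_with_timefun _ _ _ (fun t => eta / (T - t)) (fun t => eta / (T - t) ^+ 2)).
  by move=> r /andP[_ rT]; split; [exact: barrier_derive|exact: barrier_derive_continuous].
have jap : C1_with (open_strip T : set S) (fun r => de * \sum_j japanese 0 (r.1 0 j))
    (fun r v => de * \sum_j japanese' 0 (r.1 0 j) * v.1 0 j).
  apply: C1_withZ; apply: (@C1_with_sep _ _ _ (fun=> japanese 0) (fun=> japanese' 0)) => j.
  exact: C1_fun_japanese.
have dphi := C1_withD (C1_with_quad m (q.1 + h) (q.2 + ta) (Omega := open_strip T)) (C1_withD jap bar).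
have tphi : touches_above U phi p.
  apply: filterS (slab p pslab) => r hr.
  have := gmx r q hr; rewrite (ltW qtau) qT => /(_ isT).
  by rewrite /Phi /phi /=; clear => *; lra.
pose psi (r : S) := - ((\sum_j m * (r.1 0 j - (p.1 - h) 0 j) ^+ 2 + m * (r.2 - (p.2 - ta)) ^+ 2) +
  eta / (T - r.2)).
have dpsi := C1_withN (C1_withD (C1_with_quad m (p.1 - h) (p.2 - ta) (Omega := open_strip T)) bar).
have sym (r : S) : \sum_j m * (r.1 0 j - (p.1 - h) 0 j) ^+ 2 + m * (r.2 - (p.2 - ta)) ^+ 2 =
    \sum_j m * (p.1 0 j - (r.1 + h) 0 j) ^+ 2 + m * (p.2 - (r.2 + ta)) ^+ 2.
  by congr (_ + _); [apply: eq_bigr => j _; rewrite !mxE|]; ring.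
have tpsi : touches_below Lo psi q.
  apply: filterS (slab q qslab) => r hr.
  have := gmx p r; rewrite (ltW ptau) pT => /(_ isT hr).
  by rewrite /Phi /psi /= !sym; clear => *; lra.
have oO := @open_open_strip R n T.
have := sub phi p (C1_with_C1 oO dphi) sp tphi.
have := sup psi q (C1_with_C1 oO dpsi) sq tpsi.
rewrite (C1_with_time_deriv dphi sp) (C1_with_space_grad dphi sp).
rewrite (C1_with_time_deriv dpsi sq) (C1_with_space_grad dpsi sq) /dirt /= !sum_zero.
set Q := \row_j _; set P := \row_j _.
have QE j : Q 0 j = m * (2 * (p.1 - (q.1 + h)) 0 j).
  by rewrite mxE /dirx /= sum_delta !mulr0 !mxE; ring.
have PE j : P 0 j = Q 0 j + de * japanese' 0 (p.1 0 j).
  by rewrite QE mxE /dirx /= !sum_delta !mulr0 !mxE; ring.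
have Qle : `|P - Q| <= dl.
  apply: rVnorm_le => [|j]; first exact: ltW.
  have -> : (P - Q) 0 j = P 0 j - Q 0 j by rewrite !mxE.
  rewrite PE (addrC (Q 0 j)) addrK normrM (gtr0_norm de0).
  apply: le_trans (_ : de <= dl) => //.
  by rewrite -[leRHS]mulr1 ler_wpM2l ?(ltW de0)// japanese'_le1.
have Qr : `|Q| <= 2 * m * ab.
  apply: rVnorm_le => [|j]; first by apply: mulr_ge0; [apply: mulr_ge0|]; rewrite // ltW.
  have : `|(p.1 - (q.1 + h)) 0 j| <= ab.
    by apply: le_trans (coord_le_norm _ _) _; exact: Phia.
  have m2 : 0 < 2 * m by exact: mulr_gt0.
  rewrite QE mulrA (mulrC m) (normrM (2 * m)) (gtr0_norm m2) => hh.
  exact: (ler_wpM2l (ltW m2) hh).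
(* In the difference of the two inequalities the time derivatives of the penalty cancel. The
   barriers contribute at least [2 eta / T^2], while [Hbar] changes by less than [eta / T^2] between
   [P] and [Q]. *)
have := hdl Q P Qr; rewrite distrC => /(_ Qle); rewrite ltr_norml => /andP[_].
have etas t : 0 < t < T -> eta / T ^+ 2 <= eta / (T - t) ^+ 2.
  move=> /andP[t1 t2]; apply: ler_wpM2l; first exact: ltW.
  rewrite lef_pV2 ?posrE ?exprn_gt0 ?subr_gt0// lerXn2r ?nnegrE ?subr_ge0 ?ltW//.
  by rewrite ltrBlDr ltrDl.
have := etas _ sp; have := etas _ sq.
have : 0 < eta / T ^+ 2 by rewrite divr_gt0// exprn_gt0.
rewrite !mulr0 !add0r !mulr1.
by clear => *; lra.
Qed.

End Comparison.

(** * Cell problem *)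

Section CellProblem.
Context {R : realType} {n : nat}.
Notation V := 'rV[R]_n.
Notation S := ('rV[R]_n * R)%type.
Implicit Types (H : bool -> V -> V -> R) (v : bool -> V -> R) (P : V) (c : R).

Definition cell_sub H P c v := forall i, viscosity_subsolution setT
  (fun phi xi => H i xi (P + grad phi xi) + v i xi - v (~~ i) xi - c) (v i).

Definition cell_super H P c v := forall i, viscosity_supersolution setT
  (fun phi xi => H i xi (P + grad phi xi) + v i xi - v (~~ i) xi - c) (v i).

Lemma cell_sub_test H P c v i phi D x :
  cell_sub H P c v -> C1_with setT phi D -> touches_above (v i) phi x ->
  H i x (P + \row_j D x (delta_mx 0 j)) + v i x - v (~~ i) x <= c.
Proof.
move=> h hphi t; have := h i phi x (C1_with_C1 openT hphi) I t.
by rewrite (C1_with_grad hphi)// subr_le0.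
Qed.

Lemma cell_super_test H P c v i phi D x :
  cell_super H P c v -> C1_with setT phi D -> touches_below (v i) phi x ->
  c <= H i x (P + \row_j D x (delta_mx 0 j)) + v i x - v (~~ i) x.
Proof.
move=> h hphi t; have := h i phi x (C1_with_C1 openT hphi) I t.
by rewrite (C1_with_grad hphi)// subr_ge0.
Qed.

Lemma C1_with_quadV (m : R) (a : V) :
  C1_with setT (fun x : V => \sum_j m * (x 0 j - a 0 j) ^+ 2)
   (fun x w => \sum_j m * (2 * (x 0 j - a 0 j)) * w 0 j).
Proof.
apply: (@C1_with_sepV _ _ _ (fun j t => m * (t - a 0 j) ^+ 2) (fun j t => m * (2 * (t - a 0 j)))).
by move=> j; exact: C1_fun_sqr.
Qed.

Lemma fst_norm_le (p : S) : `|p.1| <= `|p|.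
Proof. by have := lexx `|p|; rewrite {1}[p]surjective_pairing => /norm_pair_le[]. Qed.

Lemma snd_norm_le (p : S) : `|p.2| <= `|p|.
Proof. by have := lexx `|p|; rewrite {1}[p]surjective_pairing => /norm_pair_le[]. Qed.

Lemma space_time_cball_compact (p0 : S) r : compact [set p : S | `|p - p0| <= r].
Proof.
have -> : [set p : S | `|p - p0| <= r] =
    (fun p => p + p0) @` [set p : S | `|p.1| <= r /\ - r <= p.2 <= r].
  apply/seteqP; split=> [p /= h|_ [p [h1 h2] <-]] /=.
    exists (p - p0); last by rewrite subrK.
    by move: h => /norm_pair_le [h1]; rewrite ler_norml.
  by rewrite addrK [p]surjective_pairing; apply/norm_pair_le; rewrite ler_norml.
apply: continuous_compact; last exact: space_time_box_compact.
by apply: continuous_subspaceT => x; apply: cvgD; [exact: cvg_id|exact: cvg_cst].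
Qed.

(* Only the fast variable is doubled (y = p.1 / eps + z).  Choosing the component
   attaining the maximum makes the coupling terms of the two inequalities cancel,
   and q is bounded through coercivity, so no Lipschitz bound on u or v is used. *)
Lemma perturbed_test_maximum T H u v eps P c B (phi : S -> R) D p0 r mm i0 p1 d :
  0 < eps -> subsystem T (fun i x => H i (eps^-1 *: x)) eps^-1 u ->
  (forall i, usc_in (open_strip T) (u i)) ->
  (forall i, continuous (v i)) -> (forall i x, `|v i x| <= B) ->
  cell_super H P c v -> C1_with (open_strip T) phi D ->
  [set p | `|p - p0| <= r] `<=` open_strip T ->
  (forall i p, r / 2 <= `|p - p0| -> `|p - p0| <= r -> u i p - phi p <= mm) ->
  `|p1 - p0| <= r -> mm + 2 * (eps * B) < u i0 p1 - phi p1 -> 0 < d ->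
  exists i p q y, [/\ `|p - p0| <= r, `|eps^-1 *: p.1 - y| <= d,
    D p dirt + H i (eps^-1 *: p.1) (test_gradient D p + q) - H i y (P + q) + c <= 0,
    H i (eps^-1 *: p.1) (test_gradient D p + q) <= 2 * B - D p dirt &
    c - 2 * B <= H i y (P + q)].
Proof.
move=> e0 hu uu cv vB sup hphi rT ann p1r gt d0.
have B0 : 0 <= B by exact: le_trans (vB true 0).
have eB0 : 0 <= eps * B by rewrite mulr_ge0// ltW.
have ei0 : 0 < eps^-1 by rewrite invr_gt0.
(* The cap [1 / 2] keeps [z] away from the boundary of the unit ball, leaving room to vary either
   variable in the two tests below. *)
pose d' := Num.min d (1 / 2).
have d'0 : 0 < d' by rewrite lt_min d0 divr_gt0.
(* Replacing [z] by 0 changes the corrector term by at most [2 eps B]; this [m] makes the penalty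
   larger than that as soon as [|z| >= d']. *)
pose m := (2 * (eps * B) + 1) / d' ^+ 2.
have m0 : 0 < m by apply: divr_gt0; [rewrite ltr_wpDl// mulr_ge0|exact: exprn_gt0].
pose K := [set p : S | `|p - p0| <= r] `*` [set z : V | `|z| <= 1].
have cK : compact K by apply: compact_setX; [exact: space_time_cball_compact|exact: normr_cball_compact].
pose pert i (z : S * V) := phi z.1 + eps * v i (eps^-1 *: z.1.1 + z.2) + \sum_j m * (z.2 0 j) ^+ 2.
pose Phi i (z : S * V) := u i z.1 + - pert i z.
have uPhi i : usc_in K (Phi i).
  apply: usc_inD.
    by apply: (usc_in_comp (A := open_strip T)) (uu i) => [z [+ _]|z _]; [exact: rT|exact: cvg_fst].
  apply: continuous_usc_in => z [/rT z1 _]; apply: continuousN.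
  apply: continuousD; first apply: continuousD.
  - apply: (@continuous_comp _ _ _ fst phi); first exact: cvg_fst.
    by apply: differentiable_continuous; have [? _] := hphi _ z1; exact: ex_diff.
  - apply: continuousM; first exact: cst_continuous.
    apply: (@continuous_comp _ _ _ (fun z : S * V => eps^-1 *: z.1.1 + z.2) (v i)); last exact: cv.
    apply: continuousD; last exact: cvg_snd.
    apply: (@continuous_comp _ _ _ (fun z : S * V => z.1.1) (fun x : V => eps^-1 *: x)); last exact: scaler_continuous.
    by apply: (@continuous_comp _ _ _ (fun z : S * V => z.1) fst); exact: cvg_fst.
  - apply: continuous_sum => j; apply: continuousM; first exact: cst_continuous.
    have cz : {for z, continuous (fun z : S * V => z.2 0 j)}.
      by apply: (@continuous_comp _ _ _ (fun z : S * V => z.2) (fun y : V => y 0 j)); [exact: cvg_snd|exact: coord_continuous].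
    exact: continuousM.
have Kp1 : K (p1, 0) by split=> //=; rewrite normr0.
have [i [[p z] [Kpz mx]]] := usc_max_compact2 cK (ex_intro _ _ Kp1) uPhi.
have [/= pr z1] := Kpz.
have vB2 j x y : eps * v j x - eps * v j y <= 2 * (eps * B).
  have := vB j x; have := vB j y; rewrite !ler_norml => /andP[h1 h2] /andP[h3 h4].
  have : v j x - v j y <= 2 * B by lra.
  move=> /(ler_wpM2l (ltW e0)); lra.
have vBe j x : - (eps * B) <= eps * v j x <= eps * B.
  have := vB j x; rewrite ler_norml => /andP[h1 h2]; apply/andP; split.
    by rewrite -mulrN; apply: ler_wpM2l => //; exact: ltW.
  by apply: ler_wpM2l => //; exact: ltW.
have sum0 : \sum_(j < n) m * (0 : V) 0 j ^+ 2 = 0.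
  by rewrite big1// => j _; rewrite mxE expr0n mulr0.
have sumz_ge0 : 0 <= \sum_j m * z 0 j ^+ 2.
  by apply: sumr_ge0 => j _; rewrite mulr_ge0 ?sqr_ge0// ltW.
have zd : `|z| < d'.
  have Kp : K (p, 0) by split=> //=; rewrite normr0.
  have := mx i _ Kp; rewrite /Phi /pert /= sum0.
  have := vB2 i (eps^-1 *: p.1 + 0) (eps^-1 *: p.1 + z) => h1 h2.
  have : m * `|z| ^+ 2 < m * d' ^+ 2.
    have -> : m * d' ^+ 2 = 2 * (eps * B) + 1.
      by rewrite /m mulfVK// gt_eqF// exprn_gt0.
    apply: (@le_lt_trans _ _ (\sum_j m * z 0 j ^+ 2)); last lra.
    by rewrite -mulr_sumr; apply: ler_wpM2l; [exact: ltW|exact: norm_sq_le_sum].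
  by rewrite ltr_pM2l// ltr_pXn2r ?nnegrE ?(ltW d'0).
have z12 : `|z| < 1 / 2 by rewrite (lt_le_trans zd)// ge_min lexx orbT.
have zdd : `|z| <= d by rewrite (le_trans (ltW zd))// ge_min lexx.
(* On the outer half of the ball [u - phi] is below its value at [p1] by more than the oscillation
   [2 eps B] of the corrector term, so the maximum lies in the inner half. *)
have pr2 : `|p - p0| < r / 2.
  rewrite ltNge; apply/negP => h; have := ann i p h pr.
  have := mx i0 _ Kp1; rewrite /Phi /pert /= sum0.
  have /andP[a1 a2] := vBe i0 (eps^-1 *: p1.1 + 0).
  have /andP[a3 a4] := vBe i (eps^-1 *: p.1 + z).
  lra.
pose y := eps^-1 *: p.1 + z.
have cmp : v i y - v (~~ i) y <= eps^-1 * (u i p - u (~~ i) p).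
  have := mx (~~ i) _ Kpz; rewrite /Phi /pert /= -/y => h.
  by rewrite mulrC ler_pdivlMr//; lra.
(* Common penalty gradient of the two tests: [y] varies with [p] fixed for the corrector, [p] varies
   with [y] fixed for [u i]. In the latter [p] moves by less than [eps / 2], so that [z] stays in
   the unit ball. *)
pose q : V := - (2 * (m / eps)) *: z.
pose chi (y' : V) := \sum_j (- (m / eps)) * (y' 0 j - (eps^-1 *: p.1) 0 j) ^+ 2.
have dchi := C1_with_quadV (- (m / eps)) (eps^-1 *: p.1).
have tchi : touches_below (v i) chi y.
  apply/nbhs_normP; exists (1 / 2) => /=; first by rewrite divr_gt0.
  move=> y' /= yy'.
  have Kz : K (p, y' - eps^-1 *: p.1).
    split=> //=; have -> : y' - eps^-1 *: p.1 = z - (y - y').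
      by rewrite /y; apply/rowP => j; rewrite !mxE; ring.
    by rewrite (le_trans (ler_normB _ _))//; lra.
  have := mx i _ Kz; rewrite /Phi /pert /= -/y (addrC (eps^-1 *: p.1)) subrK => h.
  have e1 w : chi w = - (eps^-1 * \sum_j m * (w - eps^-1 *: p.1) 0 j ^+ 2).
    by rewrite mulr_sumr -sumrN; apply: eq_bigr => j _; rewrite !mxE; ring.
  rewrite !e1.
  have -> : y - eps^-1 *: p.1 = z by rewrite /y addrAC subrr add0r.
  have : 0 <= eps^-1 * (eps * v i y' - eps * v i y + (\sum_j m * (y' - eps^-1 *: p.1) 0 j ^+ 2 - \sum_j m * z 0 j ^+ 2)).
    by apply: mulr_ge0; [exact: ltW|lra].
  by rewrite mulrDr mulrBr !mulKf ?gt_eqF//; lra.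
have qchi : \row_j \sum_l - (m / eps) * (2 * (y 0 l - (eps^-1 *: p.1) 0 l)) * (delta_mx 0 j : V) 0 l = q.
  by apply/rowP => j; rewrite mxE sum_delta /q /y !mxE; ring.
have sI := cell_super_test sup dchi tchi; rewrite qchi in sI.
pose Q (p' : S) := \sum_j (m / eps ^+ 2) * (p'.1 0 j - eps * y 0 j) ^+ 2.
have dQ : C1_with (open_strip T) (fun p' => phi p' + Q p') (fun p' w => D p' w +
   \sum_j (m / eps ^+ 2) * (2 * (p'.1 0 j - eps * y 0 j)) * w.1 0 j).
  apply: C1_withD => //.
  apply: (@C1_with_sep _ _ _ (fun j t => (m / eps ^+ 2) * (t - eps * y 0 j) ^+ 2)
    (fun j t => (m / eps ^+ 2) * (2 * (t - eps * y 0 j)))) => j.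
  exact: C1_fun_sqr.
have tQ : touches_above (u i) (fun p' => phi p' + Q p') p.
  apply/nbhs_normP; exists (Num.min (r / 2) (eps / 2)) => /=.
    by rewrite lt_min (le_lt_trans (normr_ge0 _) pr2) divr_gt0.
  move=> p' /=; rewrite lt_min => /andP[pp1 pp2].
  have QE w : Q w = \sum_j m * (y - eps^-1 *: w.1) 0 j ^+ 2.
    by apply: eq_bigr => j _; rewrite !mxE; field; rewrite gt_eqF.
  have Kz : K (p', y - eps^-1 *: p'.1).
    split=> /=.
      have := ler_distD p p' p0; rewrite (distrC p' p); lra.
    have -> : y - eps^-1 *: p'.1 = z + eps^-1 *: (p - p').1.
      by rewrite /y scalerBr /=; apply/rowP => j; rewrite !mxE; ring.
    rewrite (le_trans (ler_normD _ _))// normrZ gtr0_norm//.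
    have : eps^-1 * `|(p - p').1| <= eps^-1 * (eps / 2).
      by apply: ler_wpM2l; [exact: ltW|exact: le_trans (fst_norm_le _) (ltW pp2)].
    by rewrite mulKf ?gt_eqF//; lra.
  have := mx i _ Kz; rewrite /Phi /pert /= -/y (addrC (eps^-1 *: p'.1)) subrK !QE.
  have -> : y - eps^-1 *: p.1 = z by rewrite /y addrAC subrr add0r.
  lra.
have sp : open_strip T p by exact: rT.
have uI := subsystem_test hu dQ sp tQ.
have qQ : test_gradient (fun p' w => D p' w +
   \sum_j (m / eps ^+ 2) * (2 * (p'.1 0 j - eps * y 0 j)) * w.1 0 j) p = test_gradient D p + q.
  apply/rowP => j; rewrite !mxE /dirx /= sum_delta /q /y !mxE; congr (_ + _).
  by field; rewrite gt_eqF.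
rewrite qQ /dirt /= sum_zero addr0 in uI.
have := vB i y; have := vB (~~ i) y; rewrite !ler_norml => /andP[h1 h2] /andP[h3 h4].
exists i, p, q, y; split=> //.
- by rewrite /y opprD addrA subrr sub0r normrN.
- rewrite -/dirt in uI; lra.
- rewrite -/dirt in uI; lra.
- lra.
Qed.

End CellProblem.

Lemma continuous_dist {R : realType} (V : normedModType R) (f : V -> R) :
  (forall x e, 0 < e -> exists2 d, 0 < d &
     forall y, `|x - y| < d -> `|f x - f y| < e) -> continuous f.
Proof.
move=> h x; apply/cvgrPdist_lt => e /(h x) [d d0 hd].
by apply/nbhs_normP; exists d.
Qed.

Definition pairb {A : Type} (a1 a2 : A) (i : bool) : A := if i then a1 else a2.

(** * Continuity of the effective Hamiltonian *)

Section EffectiveHamiltonian.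
Context {R : realType} {n : nat}.
Notation V := 'rV[R]_n.
Implicit Types (H : bool -> V -> V -> R) (v w : bool -> V -> R) (P : V) (c : R).

Lemma periodic_bounded (f : V -> R) : continuous f -> integer_periodic f ->
  exists B, forall x, `|f x| <= B.
Proof.
move=> cf pf; pose K := [set x : V | `|x| <= 1].
have K0 : K !=set0 by exists 0; rewrite /K/= normr0.
have uf : usc_in K (fun x => `|f x|).
  by apply: continuous_usc_in => x _; exact: (cvg_norm (cf x)).
have [x0 _ h] := usc_max_compact (@normr_cball_compact R n 1) K0 uf.
exists `|f x0| => x; have [z hz] := integer_part_vec x.
by rewrite -(pf x z); exact: h.
Qed.

(** Doubling of variables on the torus, producing the same increment [q] for both slopes. The last
    clause accepts a bound on either corrector: when a fixed [P] is compared with a moving [P'],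
    only the corrector at [P] has a bound known in advance. *)
Lemma cell_comparison H P c v P' c' w B d :
  (forall i, continuous (v i)) -> (forall i, continuous (w i)) ->
  (forall i, integer_periodic (v i)) -> (forall i, integer_periodic (w i)) ->
  (forall i x, `|v i x| <= B) ->
  cell_super H P c v -> cell_sub H P' c' w -> 0 < d ->
  exists i x y q, [/\ `|x - y| <= d,
    c - c' <= H i y (P + q) - H i x (P' + q) &
    forall B', (forall i x, `|v i x| <= B') \/ (forall i x, `|w i x| <= B') ->
      H i x (P' + q) <= c' + 2 * B'].
Proof.
move=> cv cw pv pw vB sup sub d0.
have B0 : 0 <= B by exact: le_trans (vB true 0).
pose d' := Num.min d (1 / 2).
have d'0 : 0 < d' by rewrite lt_min d0 divr_gt0.
pose m := (2 * B + 1) / d' ^+ 2.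
have m0 : 0 < m by apply: divr_gt0; [rewrite ltr_wpDl// mulr_ge0|exact: exprn_gt0].
pose K := [set x : V | `|x| <= 1] `*` [set z : V | `|z| <= 1].
have cK : compact K by apply: compact_setX; exact: normr_cball_compact.
pose pert i (z : V * V) := v i (z.1 + z.2) + \sum_j m * (z.2 0 j) ^+ 2.
pose Phi i (z : V * V) := w i z.1 + - pert i z.
have uPhi i : usc_in K (Phi i).
  apply: continuous_usc_in => z _; apply: continuousD; last apply: continuousN.
    by apply: (@continuous_comp _ _ _ (fun z : V * V => z.1) (w i)); [exact: cvg_fst|exact: cw].
  apply: continuousD.
    apply: (@continuous_comp _ _ _ (fun z : V * V => z.1 + z.2) (v i)); last exact: cv.
    by apply: continuousD; [exact: cvg_fst|exact: cvg_snd].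
  apply: continuous_sum => j; apply: continuousM; first exact: cst_continuous.
  have cz : {for z, continuous (fun z : V * V => z.2 0 j)}.
    by apply: (@continuous_comp _ _ _ (fun z : V * V => z.2) (fun y : V => y 0 j)); [exact: cvg_snd|exact: coord_continuous].
  exact: continuousM.
have K00 : K (0, 0) by split=> /=; rewrite normr0.
have [i [[x z] [Kxz mxK]]] := usc_max_compact2 cK (ex_intro _ _ K00) uPhi.
(* A common integer translation leaves [Phi] unchanged, so the maximum over the compact set is one
   over all [x]; only [z] stays confined to the ball. *)
have mx j x' z' : `|z'| <= 1 -> Phi j (x', z') <= Phi i (x, z).
  move=> z'1; have [k hk] := integer_part_vec x'.
  rewrite (_ : Phi j (x', z') = Phi j (x' + map_mx (fun k : int => k%:~R) k, z')).
    by apply: mxK; split.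
  by rewrite /Phi /pert /= addrAC pw pv.
have [/= x1 z1] := Kxz.
have sum0 : \sum_(j < n) m * (0 : V) 0 j ^+ 2 = 0.
  by rewrite big1// => j _; rewrite mxE expr0n mulr0.
have zd : `|z| < d'.
  have : Phi i (x, 0) <= Phi i (x, z) by apply: mx; rewrite normr0.
  rewrite /Phi /pert /= sum0 addr0.
  have := vB i (x + z); have := vB i (x + 0); rewrite !ler_norml => /andP[h1 h2] /andP[h3 h4] h5.
  have : m * `|z| ^+ 2 < m * d' ^+ 2.
    have -> : m * d' ^+ 2 = 2 * B + 1.
      by rewrite /m mulfVK// gt_eqF// exprn_gt0.
    apply: (@le_lt_trans _ _ (\sum_j m * z 0 j ^+ 2)); last lra.
    by rewrite -mulr_sumr; apply: ler_wpM2l; [exact: ltW|exact: norm_sq_le_sum].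
  by rewrite ltr_pM2l// ltr_pXn2r ?nnegrE ?(ltW d'0).
have z12 : `|z| < 1 / 2 by rewrite (lt_le_trans zd)// ge_min lexx orbT.
have zdd : `|z| <= d by rewrite (le_trans (ltW zd))// ge_min lexx.
pose y := x + z.
have cmp : v i y - v (~~ i) y <= w i x - w (~~ i) x.
  by have := mx (~~ i) x z z1; rewrite /Phi /pert /= -/y; lra.
pose q : V := - (2 * m) *: z.
have gen a b : `|a - x| < 1/2 -> b = y \/ a = x /\ `|b - y| < 1 / 2 ->
    w i a - v i b - \sum_j m * (b - a) 0 j ^+ 2 <= w i x - v i y - \sum_j m * (y - x) 0 j ^+ 2.
  move=> ax hb; have ba : `|b - a| <= 1.
    case: hb => [->|[-> by']].
      have -> : y - a = z - (a - x) by rewrite /y; apply/rowP => j; rewrite !mxE; ring.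
      by rewrite (le_trans (ler_normB _ _))//; lra.
    have -> : b - x = z + (b - y) by rewrite /y; apply/rowP => j; rewrite !mxE; ring.
    by rewrite (le_trans (ler_normD _ _))//; lra.
  have := mx i a _ ba; rewrite /Phi /pert /= -/y (addrC a) subrK.
  have -> : y - x = z by rewrite /y addrAC subrr add0r.
  by lra.
pose chi (y' : V) := \sum_j (- m) * (y' 0 j - x 0 j) ^+ 2.
have dchi := C1_with_quadV (- m) x.
have tchi : touches_below (v i) chi y.
  apply/nbhs_normP; exists (1 / 2) => /=; first by rewrite divr_gt0.
  move=> y' /= yy'; have e1 a : chi a = - \sum_j m * (a - x) 0 j ^+ 2.
    by rewrite -sumrN; apply: eq_bigr => j _; rewrite !mxE; ring.
  rewrite !e1.
  have : w i x - v i y' - \sum_j m * (y' - x) 0 j ^+ 2 <= w i x - v i y - \sum_j m * (y - x) 0 j ^+ 2.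
    apply: gen; first by rewrite subrr normr0 divr_gt0.
    by right; rewrite distrC.
  by lra.
have qchi : \row_j \sum_l - m * (2 * (y 0 l - x 0 l)) * (delta_mx 0 j : V) 0 l = q.
  by apply/rowP => j; rewrite mxE sum_delta /q /y !mxE; ring.
have sI := cell_super_test sup dchi tchi; rewrite qchi in sI.
pose psi (x' : V) := \sum_j m * (x' 0 j - y 0 j) ^+ 2.
have dpsi := C1_with_quadV m y.
have tpsi : touches_above (w i) psi x.
  apply/nbhs_normP; exists (1 / 2) => /=; first by rewrite divr_gt0.
  move=> x' /= xx'; have e1 a : psi a = \sum_j m * (y - a) 0 j ^+ 2.
    by apply: eq_bigr => j _; rewrite !mxE; ring.
  rewrite !e1.
  have : w i x' - v i y - \sum_j m * (y - x') 0 j ^+ 2 <= w i x - v i y - \sum_j m * (y - x) 0 j ^+ 2.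
    by apply: gen; [rewrite distrC|left].
  by lra.
have qpsi : \row_j \sum_l m * (2 * (x 0 l - y 0 l)) * (delta_mx 0 j : V) 0 l = q.
  by apply/rowP => j; rewrite mxE sum_delta /q /y !mxE; ring.
have uI := cell_sub_test sub dpsi tpsi; rewrite qpsi in uI.
exists i, x, y, q; split.
- by rewrite /y opprD addrA subrr sub0r normrN.
- lra.
move=> B' [vB'|wB'].
  have := vB' i y; have := vB' (~~ i) y; rewrite !ler_norml => /andP[h1 h2] /andP[h3 h4].
  lra.
have := wB' i x; have := wB' (~~ i) x; rewrite !ler_norml => /andP[h1 h2] /andP[h3 h4].
lra.
Qed.

Lemma cell_solvable_bool (H1 H2 : V -> V -> R) P c : cell_solvable H1 H2 P c ->
  exists v, [/\ forall i, continuous (v i), forall i, integer_periodic (v i),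
    cell_sub (pairb H1 H2) P c v & cell_super (pairb H1 H2) P c v].
Proof.
move=> [v1 [v2 [[c1 c2] [p1 p2] [s1 t1] [s2 t2]]]].
by exists (pairb v1 v2); split=> -[].
Qed.

Lemma periodic_bounded_both (v : bool -> V -> R) : (forall i, continuous (v i)) ->
  (forall i, integer_periodic (v i)) -> exists B, forall i x, `|v i x| <= B.
Proof.
move=> cv pv; have [B1 h1] := periodic_bounded (cv true) (pv true).
have [B2 h2] := periodic_bounded (cv false) (pv false).
exists (Num.max B1 B2) => -[] x.
  by rewrite le_max h1.
by rewrite le_max h2 orbT.
Qed.

Lemma unif_continuous_in_p_both H r e : (forall i, unif_continuous_in_p (H i)) -> 0 < e ->
  exists2 d, 0 < d & forall i xi xi' p p', `|p| <= r -> `|xi - xi'| <= d ->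
    `|p - p'| <= d -> `|H i xi p - H i xi' p'| < e.
Proof.
move=> h e0; have [d1 d10 h1] := h true r e e0; have [d2 d20 h2] := h false r e e0.
exists (Num.min d1 d2) => [|i xi xi' p p' pr]; first by rewrite lt_min d10.
rewrite !le_min => /andP[a1 a2] /andP[b1 b2].
by case: i; [exact: h1|exact: h2].
Qed.

(** The radius [r] and the modulus [d] are fixed from the corrector at [P], before [P'] is chosen;
    coercivity then bounds the gradient in both comparisons through the same [B]. *)
Lemma effective_continuous (H1 H2 : V -> V -> R) Hbar : hamiltonian H1 -> hamiltonian H2 ->
  effective_hamiltonian H1 H2 Hbar -> continuous Hbar.
Proof.
move=> hH1 hH2 eff; apply: continuous_dist => P e e0.
pose H := pairb H1 H2.
have uH i : unif_continuous_in_p (H i).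
  by case: i; exact: hamiltonian_unif_continuous.
have cH C : exists r, forall i xi p, H i xi p <= C -> `|p| <= r.
  have [r1 h1] := hamiltonian_coercive hH1 C; have [r2 h2] := hamiltonian_coercive hH2 C.
  exists (Num.max r1 r2) => -[] xi p.
    by move=> /h1 h; rewrite le_max h.
  by move=> /h2 h; rewrite le_max h orbT.
have [v [cv pv subv supv]] := cell_solvable_bool (eff P).1.
have [B vB] := periodic_bounded_both cv pv.
(* The summand [e] is for the second comparison, whose level [Hbar P'] is known from the first one
   to be below [Hbar P + e]. *)
have [r hr] := cH (Hbar P + e + 2 * B).
have [d d0 hd] := unif_continuous_in_p_both r uH e0.
exists d => // P' /ltW PP.
have [w [cw pw subw supw]] := cell_solvable_bool (eff P').1.
have [B' wB'] := periodic_bounded_both cw pw.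
have up : Hbar P' - Hbar P < e.
  have [i [x [y [q [xy h1 h2]]]]] := cell_comparison cw cv pw pv wB' supw subv d0.
  apply: le_lt_trans h1 _.
  have Pq : `|P + q| <= r.
    apply: (hr i x); apply: le_trans (h2 B (or_intror vB)) _; lra.
  have := hd i x y (P + q) (P' + q) Pq xy.
  rewrite opprD addrACA subrr addr0 => /(_ PP).
  by rewrite distrC; apply: le_lt_trans; exact: ler_norm.
have lo : Hbar P - Hbar P' < e.
  have [i [x [y [q [xy h1 h2]]]]] := cell_comparison cv cw pv pw vB supv subw d0.
  apply: le_lt_trans h1 _.
  have Pq : `|P' + q| <= r.
    apply: (hr i x); apply: le_trans (h2 B (or_introl vB)) _; lra.
  have := hd i x y (P' + q) (P + q) Pq xy.
  rewrite opprD addrACA subrr addr0 distrC => /(_ PP).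
  by rewrite distrC; apply: le_lt_trans; exact: ler_norm.
rewrite ltr_norml; apply/andP; split; lra.
Qed.

Lemma effective_loc_unif_continuous (H1 H2 : V -> V -> R) Hbar : hamiltonian H1 -> hamiltonian H2 ->
  effective_hamiltonian H1 H2 Hbar -> loc_unif_continuous Hbar.
Proof.
move=> h1 h2 eff r e e0.
have [d d0 h] := unif_continuous_compact (@normr_cball_compact R n r)
  (effective_continuous h1 h2 eff) e0.
by exists d.
Qed.

End EffectiveHamiltonian.

(** * Half-relaxed limits *)

Section HalfRelaxedLimit.
Context {R : realType} {W : normedModType R}.
Implicit Types (w : R -> bool -> W -> R) (p q : W).

(** Point and parameter vary jointly, as half-relaxed limits require: the point may move with the
    parameter. *)
Definition eventually_at p (Q : W -> R -> Prop) :=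
  exists2 d, 0 < d & forall q e, `|p - q| < d -> 0 < e < d -> Q q e.

(** Upper half-relaxed limit, taken over both components at once, as the infimum of the eventual
    upper bounds near [p]. The lower limit is obtained as [- ulim (- w)]. *)
Definition ulim w p : R :=
  inf [set c | eventually_at p (fun q e => forall i, w e i q <= c)].

Definition locally_bounded_at w p :=
  exists b, eventually_at p (fun q e => forall i, `|w e i q| <= b).

Lemma eventually_at_sub p (Q Q' : W -> R -> Prop) :
  (forall q e, 0 < e -> Q q e -> Q' q e) -> eventually_at p Q -> eventually_at p Q'.
Proof.
move=> QQ' [d d0 h]; exists d => // q e qd /[dup] /andP[e0 _] ed.
exact: QQ' e0 (h _ _ qd ed).
Qed.

Lemma eventually_atI p (Q Q' : W -> R -> Prop) :
  eventually_at p Q -> eventually_at p Q' -> eventually_at p (fun q e => Q q e /\ Q' q e).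
Proof.
move=> [d d0 h] [d' d'0 h']; exists (Num.min d d') => [|q e]; first by rewrite lt_min d0.
by rewrite !lt_min => /andP[q1 q2] /and3P[e0 e1 e2]; split; [apply: h|apply: h']; rewrite ?e0.
Qed.

Lemma eventually_at_nbhs p (Q : W -> Prop) :
  (\forall q \near p, Q q) -> eventually_at p (fun q e => Q q).
Proof. by move=> /nbhs_normP[d /= d0 h]; exists d => // q e qd _; exact: h. Qed.

Lemma eventually_at_ex p (Q : W -> R -> Prop) :
  eventually_at p Q -> exists e, 0 < e /\ Q p e.
Proof.
move=> [d d0 h]; exists (d / 2); split; first by rewrite divr_gt0.
by apply: h; rewrite ?subrr ?normr0 ?divr_gt0//=; lra.
Qed.

Lemma eventually_at_open p (Q : W -> R -> Prop) :
  eventually_at p Q -> \forall q \near p, eventually_at q Q.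
Proof.
move=> [d d0 h]; apply/nbhs_normP; exists (d / 2) => /=; first by rewrite divr_gt0.
move=> q /= pq; exists (d / 2) => [|r e qr /andP[e0 ed]]; first by rewrite divr_gt0.
apply: h; first by have := ler_distD q p r; lra.
by rewrite e0/=; lra.
Qed.

(** Near-covering compactness yields a common threshold for the parameter; it serves both the
    annulus around a contact point and the locally uniform convergence. *)
Lemma eventually_at_compact (K : set W) (Q : W -> R -> Prop) : compact K ->
  (forall p, K p -> eventually_at p Q) ->
  exists2 d, 0 < d & forall q e, K q -> 0 < e < d -> Q q e.
Proof.
move=> /compact_near_coveringP cK h.
have [p Kp|d /= d0 hd] := cK _ (0^'+ : set_system R) (fun e q => Q q e) _.
  have [d d0 hd] := h p Kp.
  exists ([set q | `|p - q| < d], [set e | 0 < e < d]).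
    split; first by apply/nbhs_normP; exists d.
    by exists d => //= e /=; rewrite sub0r normrN => + e0; rewrite gtr0_norm// e0.
  by move=> [q e] /= [qd ed]; exact: hd.
exists d => // q e Kq /andP[e0 ed]; apply: (hd e) => //=.
by rewrite sub0r normrN gtr0_norm.
Qed.

Lemma has_inf_ulim w p : locally_bounded_at w p ->
  has_inf [set c | eventually_at p (fun q e => forall i, w e i q <= c)].
Proof.
move=> [b hb]; split.
  by exists b; apply: eventually_at_sub hb => q e _ h i; apply: le_trans (h i); exact: ler_norm.
exists (- b) => c hc; have [e [_ [h1 h2]]] := eventually_at_ex (eventually_atI hb hc).
by have := h1 true; have := h2 true; rewrite ler_norml => h3 /andP[]; lra.
Qed.

Lemma ulim_lt w p c : locally_bounded_at w p -> ulim w p < c ->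
  eventually_at p (fun q e => forall i, w e i q < c).
Proof.
move=> /has_inf_ulim hi /(inf_lt hi.1)[c' /= hc' cc'].
by apply: eventually_at_sub hc' => q e _ h i; exact: le_lt_trans (h i) cc'.
Qed.

Lemma lt_ulim w p c d : locally_bounded_at w p -> c < ulim w p -> 0 < d ->
  exists q e i, [/\ `|p - q| < d, 0 < e < d & c < w e i q].
Proof.
move=> hb hc d0; apply: contrapT => h.
have := ltNge c (ulim w p); rewrite hc => /esym/negP; apply.
apply: ge_inf; first exact: (has_inf_ulim hb).2.
exists d => // q e qd ed i; rewrite leNgt; apply/negP => hh.
by apply: h; exists q, e, i.
Qed.

Lemma ulim_le w p c : locally_bounded_at w p ->
  eventually_at p (fun q e => forall i, w e i q <= c) -> ulim w p <= c.
Proof. by move=> hb h; apply: ge_inf => //; exact: (has_inf_ulim hb).2. Qed.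

(** A bound valid eventually at [p] remains valid eventually at all nearby points. *)
Lemma usc_ulim w (A : set W) : (forall p, A p -> locally_bounded_at w p) ->
  usc_in A (ulim w).
Proof.
move=> hb p Ap c hc.
pose c' := (ulim w p + c) / 2.
have h1 : ulim w p < c' by rewrite /c'; lra.
have h2 : c' < c by rewrite /c'; lra.
have := eventually_at_open (ulim_lt (hb p Ap) h1).
apply: filterS => q hq Aq; apply: le_lt_trans h2; apply: ulim_le; first exact: hb.
by apply: eventually_at_sub hq => r e _ h i; exact/ltW.
Qed.

Lemma locally_bounded_atN w p : locally_bounded_at w p ->
  locally_bounded_at (fun e i q => - w e i q) p.
Proof.
move=> [b hb]; exists b; apply: eventually_at_sub hb => q e _ h i.
by rewrite normrN.
Qed.

Lemma llim_le_ulim w p : locally_bounded_at w p ->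
  - ulim (fun e i q => - w e i q) p <= ulim w p.
Proof.
move=> hb; have hbN := locally_bounded_atN hb.
rewrite leNgt; apply/negP => h.
pose c := (ulim w p - ulim (fun e i q => - w e i q) p) / 2.
have h1 : ulim w p < c by rewrite /c; lra.
have h2 : ulim (fun e i q => - w e i q) p < - c by rewrite /c; lra.
have [e [_ [/(_ true) a1 /(_ true) a2]]] := eventually_at_ex (eventually_atI (ulim_lt hb h1) (ulim_lt hbN h2)).
lra.
Qed.

End HalfRelaxedLimit.

(** * Perturbed test functions *)

Section PerturbedTestFunction.
Context {R : realType} {n : nat}.
Notation V := 'rV[R]_n.
Notation S := ('rV[R]_n * R)%type.
Implicit Types (H : bool -> V -> V -> R) (w : R -> bool -> S -> R).

Lemma semicoercive_both H C : (forall i, semicoercive (H i)) ->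
  exists r, forall i xi xi' p p', `|p - p'| <= 1 -> H i xi p <= C ->
    - C <= H i xi' p' -> `|p| <= r.
Proof.
move=> h; have [r1 h1] := h true C; have [r2 h2] := h false C.
exists (Num.max r1 r2) => -[] xi xi' p p' pp HC HC'.
  by rewrite le_max (h1 xi xi' p p').
by rewrite le_max (h2 xi xi' p p')// orbT.
Qed.

Lemma near_dist_ltP (W : normedModType R) (p : W) (Q : W -> Prop) :
  (\forall q \near p, Q q) <-> exists2 d, 0 < d & forall q, `|p - q| < d -> Q q.
Proof.
split=> [/nbhs_normP[d /= d0 h]|[d d0 h]]; first by exists d.
by apply/nbhs_normP; exists d.
Qed.

Lemma continuous_at_near (W : normedModType R) (f : W -> R) (p : W) e :
  {for p, continuous f} -> 0 < e -> \forall q \near p, `|f p - f q| < e.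
Proof. by move=> /cvgrPdist_lt; apply. Qed.

(* The system is tested at a maximum of w - psi - eps v (x / eps), where psi is
   the test function made strict by a quadratic term. *)
Lemma ulim_subsolution T H (Hbar : V -> R) w :
  (forall i, regular (H i)) ->
  (forall P, exists v, [/\ forall i, continuous (v i),
     forall i, integer_periodic (v i) & cell_super H P (Hbar P) v]) ->
  (forall e, 0 < e -> subsystem T (fun i x => H i (e^-1 *: x)) e^-1 (w e)) ->
  (forall e i, 0 < e -> usc_in (open_strip T) (w e i)) ->
  (forall p, open_strip T p -> locally_bounded_at w p) ->
  viscosity_subsolution (open_strip T)
    (fun phi p => time_deriv phi p + Hbar (space_grad phi p)) (ulim w).
Proof.
move=> regH cell sysw uw lb phi p0 C1phi sp0 touch.
rewrite leNgt; apply/negP => /= contra.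
have dphi := C1_on_with C1phi.
pose psi (p : S) := phi p + (\sum_j 1 * (p.1 0 j - p0.1 0 j) ^+ 2 + 1 * (p.2 - p0.2) ^+ 2).
have dpsi := C1_withD dphi (C1_with_quad 1 p0.1 p0.2 (Omega := open_strip T)).
rewrite -/psi in dpsi; move: dpsi; set D := (fun x v => _) => dpsi.
have Dt0 : D p0 dirt = time_deriv phi p0.
  rewrite /D /dirt /= big1 ?subrr ?mulr0 ?mul0r ?addr0//.
  by move=> j _; rewrite subrr !mulr0 mul0r.
have Dx0 : test_gradient D p0 = space_grad phi p0.
  apply/rowP => j; rewrite !mxE /D /dirx /= big1 ?subrr ?mulr0 ?mul0r ?addr0//.
  by move=> l _; rewrite subrr !mulr0 mul0r.
set P := space_grad phi p0 in contra Dx0; set t0 := time_deriv phi p0 in contra Dt0.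
(* Half of the violation: one half is spent on the time derivative of [psi] near [p0], the other on
   the variation of [H]. *)
pose s := (t0 + Hbar P) / 2.
have s0 : 0 < s by exact: divr_gt0.
have [v [cv pv supv]] := cell P.
have [B vB] := periodic_bounded_both cv pv.
have B0 : 0 <= B by exact: le_trans (vB true 0).
(* Covers both one-sided bounds on [H] at the maximum point: [2 B + |t0| + 1] from above, where the
   1 allows for the variation of the time derivative, and [2 B + |Hbar P|] from below. *)
pose C := 2 * B + `|t0| + `|Hbar P| + 1.
have [rH hrH] := semicoercive_both C (fun i => let: And3 _ _ h := regH i in h).
have [d2 d20 hd2] := unif_continuous_in_p_both rH (fun i => let: And3 _ h _ := regH i in h) s0.
have /near_dist_ltP[ra ra0 hra] := touch.
have /near_dist_ltP[rb rb0 hrb] := open_nbhs_nbhs (conj (@open_open_strip R n T) sp0).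
have cD u0 := (dpsi p0 sp0).2 u0.
have sm0 : 0 < Num.min s 1 by rewrite lt_min s0 ltr01.
have dm0 : 0 < Num.min d2 1 by rewrite lt_min d20 ltr01.
have /near_dist_ltP[rc rc0 hrc] := continuous_at_near (cD dirt) sm0.
have : \forall p \near p0, forall j, `|D p0 (dirx j) - D p (dirx j)| < Num.min d2 1.
  refine (@filter_forall _ _ (fun j p => `|D p0 (dirx j) - D p (dirx j)| < Num.min d2 1) (nbhs p0) _ (fun j => _)).
  exact: continuous_at_near (cD (dirx j)) dm0.
move=> /near_dist_ltP[rd rd0 hrd].
pose r := Num.min (Num.min ra rb) (Num.min rc rd) / 2.
have r0 : 0 < r by rewrite divr_gt0// !lt_min ra0 rb0 rc0.
have rr p : `|p - p0| <= r -> [/\ `|p0 - p| < ra, `|p0 - p| < rb, `|p0 - p| < rc & `|p0 - p| < rd].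
  rewrite distrC => pr.
  have : `|p0 - p| < Num.min (Num.min ra rb) (Num.min rc rd).
    by apply: le_lt_trans pr _; move: r0; rewrite /r; lra.
  by rewrite !lt_min => /andP[/andP[? ?] /andP[? ?]].
have rT : [set p | `|p - p0| <= r] `<=` open_strip T.
  by move=> p /rr[_ h _ _]; exact: hrb.
pose a := ulim w p0 - phi p0.
have quad (p : S) : `|p - p0| ^+ 2 <= \sum_j 1 * (p.1 0 j - p0.1 0 j) ^+ 2 + 1 * (p.2 - p0.2) ^+ 2.
  set A := \sum_j _.
  have A0 : 0 <= A by apply: sumr_ge0 => j _; rewrite mul1r sqr_ge0.
  have h1 : `|p.1 - p0.1| ^+ 2 <= A.
    apply: le_trans (norm_sq_le_sum _) _; apply: ler_sum => j _.
    by rewrite !mxE mul1r.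
  have h2 : `|p.2 - p0.2| ^+ 2 = (p.2 - p0.2) ^+ 2 by rewrite real_normK// num_real.
  have h3 : 0 <= (p.2 - p0.2) ^+ 2 := sqr_ge0 _.
  have : `|p - p0| <= Num.max `|p.1 - p0.1| `|p.2 - p0.2|.
    rewrite [p - p0]surjective_pairing; apply/norm_pair_le.
    by rewrite !le_max !lexx orbT.
  rewrite le_max => /orP[] h; [apply: (@le_trans _ _ (`|p.1 - p0.1| ^+ 2))|apply: (@le_trans _ _ (`|p.2 - p0.2| ^+ 2))].
  - by rewrite lerXn2r// nnegrE.
  - lra.
  - by rewrite lerXn2r// nnegrE.
  - lra.
have cpsi p : open_strip T p -> {for p, continuous psi}.
  by move=> sp; apply: differentiable_continuous; have [? _] := dpsi p sp; exact: ex_diff.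
have psi0 : psi p0 = phi p0.
  rewrite /psi big1 ?subrr ?expr0n ?mulr0 ?addr0//.
  by move=> j _; rewrite subrr expr0n mulr0.
have r20 : 0 < r ^+ 2 by exact: exprn_gt0.
(* On the annulus the quadratic term is at least [r^2 / 4], so [ulim w - psi] is at most
   [a - r^2 / 4] there, whereas near [p0] some [w - psi] exceeds [a - r^2 / 16]. The level [mm]
   separates the two, with slack for the corrector once [2 e B < r^2 / 32]. *)
pose mm := a - r ^+ 2 / 8.
pose Ka := [set p : S | `|p - p0| <= r /\ r / 2 <= `|p - p0|].
have cKa : compact Ka.
  rewrite (_ : Ka = [set p : S | `|p - p0| <= r] `&` [set p : S | r / 2 <= `|p - p0|])//.
  apply: compact_closedI; first exact: space_time_cball_compact.
  apply: (@closed_comp S R (fun p : S => `|p - p0|) [set x : R | r / 2 <= x]); last exact: closed_ge.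
  by move=> p _; apply: cvg_norm; apply: cvgB; [exact: cvg_id|exact: cvg_cst].
have [e1 e10 he1] : exists2 d, 0 < d & forall q e, Ka q -> 0 < e < d -> forall i, w e i q <= psi q + mm.
  apply: (eventually_at_compact (Q := fun q e => forall i, w e i q <= psi q + mm)) => // p [pr pr2].
  have sp := rT _ pr; have [h1 _ _ _] := rr p pr.
  have r32 : 0 < r ^+ 2 / 32 by rewrite divr_gt0.
  have U1 : ulim w p < psi p + mm - r ^+ 2 / 32.
    have := hra p h1; have := quad p.
    have : (r / 2) ^+ 2 <= `|p - p0| ^+ 2.
      by apply: lerXn2r pr2; rewrite nnegrE//; exact/ltW/divr_gt0.
    have -> : (r / 2) ^+ 2 = r ^+ 2 / 4 by field.
    rewrite /psi /mm /a.
    set Q := _ + 1 * _; move: r32; move: (r ^+ 2) (`|p - p0| ^+ 2) (ulim w p) (ulim w p0) Q.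
    by clear => *; lra.
  apply: eventually_at_sub (eventually_atI (ulim_lt (lb p sp) U1)
     (eventually_at_nbhs (continuous_at_near (cpsi p sp) r32))).
  move=> q e _ [h2 h3] i; have := h2 i; move: h3; rewrite ltr_norml => /andP[]; lra.
have r32 : 0 < r ^+ 2 / 32 by rewrite divr_gt0.
have /near_dist_ltP[re re0 hre] := continuous_at_near (cpsi p0 sp0) r32.
pose dd := Num.min (Num.min r e1) (Num.min re (r ^+ 2 / (64 * (B + 1)))).
have B1 : 0 < B + 1 by rewrite ltr_wpDl.
have dd0 : 0 < dd by rewrite !lt_min r0 e10 re0 divr_gt0// mulr_gt0.
have [|q1 [e [i1 [q1d /andP[e0 ed] gt1]]]] := @lt_ulim _ _ w p0 (ulim w p0 - r ^+ 2 / 32) dd (lb p0 sp0) _ dd0.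
  by rewrite ltrBlDr ltrDl.
move: q1d ed; rewrite !lt_min => /andP[/andP[q1r _] /andP[q1re _]] /andP[/andP[_ ee1] /andP[_ eB]].
have q1r' : `|q1 - p0| <= r by rewrite distrC ltW.
have eBr : 2 * (e * B) < r ^+ 2 / 32.
  have : e * (64 * (B + 1)) < r ^+ 2 by rewrite -ltr_pdivlMr// mulr_gt0.
  have : 0 < e * 1 by rewrite mulr1.
  lra.
have gt2 : mm + 2 * (e * B) < w e i1 q1 - psi q1.
  have := hre q1 q1re; rewrite psi0 ltr_norml => /andP[]; rewrite /mm /a.
  lra.
have ann i p : r / 2 <= `|p - p0| -> `|p - p0| <= r -> w e i p - psi p <= mm.
  move=> h1 h2; have := he1 p e (conj h2 h1); rewrite e0 ee1 => /(_ isT i); lra.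
have [i [p [q [y [pr xy ineq up lo]]]]] := perturbed_test_maximum e0 (sysw e e0)
  (fun i => uw e i e0) cv vB supv dpsi rT ann q1r' gt2 d20.
have [_ _ h3 h4] := rr p pr.
have := hrc p h3; rewrite Dt0 lt_min ltr_norml => /andP[/andP[t1 t2]].
rewrite ltr_norml => /andP[t3 t4].
have Gd : `|test_gradient D p + q - (P + q)| <= Num.min d2 1.
  rewrite opprD addrACA subrr addr0 -Dx0 distrC; apply: rVnorm_le; first exact: ltW.
  by move=> j; rewrite !mxE; apply: ltW; exact: hrd.
have := Gd; rewrite le_min => /andP[G1 G2].
have nt := ler_norm t0; have nt' := ler_norm (- t0); rewrite normrN in nt'.
have nP := ler_norm (Hbar P); have nP' := ler_norm (- Hbar P); rewrite normrN in nP'.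
have Gr : `|test_gradient D p + q| <= rH.
  have := normr_ge0 (Hbar P); have := normr_ge0 t0.
  move=> n1 n2; apply: (hrH i (e^-1 *: p.1) y _ (P + q)) => //; rewrite /C.
    by move: up t4 nt' n2; clear => *; lra.
  by move: lo nP' n1; clear => *; lra.
have := hd2 i (e^-1 *: p.1) y _ (P + q) Gr xy G1.
rewrite ltr_norml => /andP[g1 _]; move: g1 t2 ineq; rewrite /s.
move: (H i _ _) (H i _ _) (D p dirt) => h1 h2 h5; clear => *; lra.
Qed.

End PerturbedTestFunction.

(** * Homogenization *)

(** McShane's formula: [F p] is the infimum of [f q + K |p - q|] over [q] in [A]. *)
Lemma lipschitz_extension {R : realType} (W : normedModType R) (A : set W)
    (f : W -> R) K : A !=set0 ->
  (forall p q, A p -> A q -> `|f p - f q| <= K * `|p - q|) -> 0 <= K ->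
  exists F : W -> R, (forall p, A p -> F p = f p) /\
    forall p q, `|F p - F q| <= K * `|p - q|.
Proof.
move=> [a Aa] fK K0.
pose E p := [set f q + K * `|p - q| | q in A].
have hE p : has_inf (E p).
  split; first by exists (f a + K * `|p - a|), a.
  exists (f a - K * `|p - a|) => _ [q Aq <-].
  have := fK a q Aa Aq; rewrite ler_norml => /andP[_].
  have : K * `|a - q| <= K * (`|p - a| + `|p - q|).
    by apply: ler_wpM2l => //; rewrite (distrC p a) ler_distD.
  by clear => *; lra.
have le p q : inf (E p) <= inf (E q) + K * `|p - q|.
  rewrite -lerBlDr; apply: lb_le_inf; first exact: (hE q).1.
  move=> _ [r Ar <-]; rewrite lerBlDr.
  apply: (@le_trans _ _ (f r + K * `|p - r|)).
    by apply: ge_inf; [exact: (hE p).2|exists r].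
  have := ler_wpM2l K0 (ler_distD q p r).
  by clear => *; lra.
exists (fun p => inf (E p)); split.
  move=> p Ap; apply/eqP; rewrite eq_le; apply/andP; split.
    by apply: ge_inf; [exact: (hE p).2|exists p => //; rewrite subrr normr0 mulr0 addr0].
  apply: lb_le_inf; first exact: (hE p).1.
  by move=> _ [q Aq <-]; have := fK p q Ap Aq; rewrite ler_norml => /andP[_]; clear => *; lra.
move=> p q; rewrite ler_norml; have := le p q; have := le q p.
by rewrite (distrC q p) => h1 h2; apply/andP; move: h1 h2; clear => *; split; lra.
Qed.

Lemma uniform_cvg_dist {R : realType} (X : choiceType) (K : set X)
    (F : R -> X -> R) (f : X -> R) :
  (forall e, 0 < e -> exists2 d, 0 < d &
     forall eps x, 0 < eps < d -> K x -> `|f x - F eps x| < e) ->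
  {uniform K, F eps @[eps --> 0^'+] --> f}.
Proof.
move=> h P /uniform_nbhs[E [entE EP]].
have [e /= e0 he] : exists2 e, 0 < e & forall a b : R, `|a - b| < e -> E (a, b).
  move: entE => /= -[e /= e0 he]; exists e => // a b ab; exact: he.
have [d d0 hd] := h e e0.
exists d => //= eps /=; rewrite sub0r normrN => epsd eps0; apply: EP => x Kx.
by apply: he; apply: hd => //; rewrite eps0 -(gtr0_norm eps0).
Qed.

Lemma touches_above_eq {R : realType} (V : normedModType R) (A : set V) (u w phi : V -> R) x :
  open A -> A x -> (forall y, A y -> u y = w y) -> touches_above u phi x -> touches_above w phi x.
Proof.
move=> oA Ax uw; apply: filterS2 (open_nbhs_nbhs (conj oA Ax)) => y Ay.
by rewrite !uw.
Qed.

Lemma touches_below_eq {R : realType} (V : normedModType R) (A : set V) (u w phi : V -> R) x :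
  open A -> A x -> (forall y, A y -> u y = w y) -> touches_below u phi x -> touches_below w phi x.
Proof.
move=> oA Ax uw; apply: filterS2 (open_nbhs_nbhs (conj oA Ax)) => y Ay.
by rewrite !uw.
Qed.

(** * Change of sign of the unknown *)

Section Reflection.
Context {R : realType} {n : nat}.
Notation V := 'rV[R]_n.
Notation S := ('rV[R]_n * R)%type.

Lemma touches_aboveN (W : normedModType R) (u phi : W -> R) x :
  touches_above (fun y => - u y) phi x -> touches_below u (fun y => - phi y) x.
Proof. by apply: filterS => y; rewrite -!opprD lerN2 !opprK. Qed.

Lemma touches_belowN (W : normedModType R) (u phi : W -> R) x :
  touches_below (fun y => - u y) phi x -> touches_above u (fun y => - phi y) x.
Proof. by apply: filterS => y; rewrite -!opprD lerN2 !opprK. Qed.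

Lemma C1_onN (W : normedModType R) (A : set W) (phi : W -> R) : open A ->
  C1_on A phi -> C1_on A (fun x => - phi x) /\
    forall x v, A x -> 'D_v (fun x => - phi x) x = - 'D_v phi x.
Proof.
move=> oA /C1_on_with /C1_withN h; split; first exact: C1_with_C1 h.
by move=> x v Ax; rewrite (C1_with_derive v h).
Qed.

Lemma supersolution_refl T (F G : (S -> R) -> S -> R) u :
  (forall phi p, C1_on (open_strip T) phi -> open_strip T p ->
     G phi p = - F (fun x => - phi x) p) ->
  viscosity_supersolution (open_strip T) F u ->
  viscosity_subsolution (open_strip T) G (fun p => - u p).
Proof.
move=> GF sup phi p C1phi sp /touches_aboveN tp.
rewrite (GF _ _ C1phi sp) oppr_le0; apply: sup => //.
by have [] := C1_onN (@open_open_strip R n T) C1phi.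
Qed.

Lemma subsolution_refl T (F G : (S -> R) -> S -> R) u :
  (forall phi p, C1_on (open_strip T) phi -> open_strip T p ->
     G phi p = - F (fun x => - phi x) p) ->
  viscosity_subsolution (open_strip T) F u ->
  viscosity_supersolution (open_strip T) G (fun p => - u p).
Proof.
move=> GF sub phi p C1phi sp /touches_belowN tp.
rewrite (GF _ _ C1phi sp) oppr_ge0; apply: sub => //.
by have [] := C1_onN (@open_open_strip R n T) C1phi.
Qed.

Lemma time_derivN T (phi : S -> R) p : C1_on (open_strip T) phi -> open_strip T p ->
  time_deriv (fun x => - phi x) p = - time_deriv phi p.
Proof. by move=> /(C1_onN (@open_open_strip R n T))[_ h] sp; exact: h. Qed.

Lemma space_gradN T (phi : S -> R) p : C1_on (open_strip T) phi -> open_strip T p ->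
  space_grad (fun x => - phi x) p = - space_grad phi p.
Proof.
move=> /(C1_onN (@open_open_strip R n T))[_ h] sp.
by apply/rowP => j; rewrite !mxE h.
Qed.

(** The effective Hamiltonian of the reflected pair is [P |-> - Hbar (- P)], and correctors for it
    come from the given cell problem at the opposite slope. *)
Lemma cell_sub_refl (H : bool -> V -> V -> R) P c v : cell_sub H P c v ->
  cell_super (fun i => refl (H i)) (- P) (- c) (fun i x => - v i x).
Proof.
move=> sub i phi x C1phi _ /touches_belowN tp.
have [C1N dN] := C1_onN openT C1phi.
have := sub i _ x C1N I tp.
have -> : grad (fun x => - phi x) x = - grad phi x.
  by apply/rowP => j; rewrite !mxE dN.
by rewrite /refl opprD opprK; clear => *; lra.
Qed.

End Reflection.

Section Assembly.
Context {R : realType} {n : nat}.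
Notation V := 'rV[R]_n.
Notation S := ('rV[R]_n * R)%type.

(** [exp (- s) <= 1 / s] with [s = 2 t / e]: an algebraic rate suffices for the limit, and its
    factor [1 / t] reflects the initial layer. *)
Lemma layer_le_mean (e : R) (f : bool -> V -> R) i (p : S) : 0 < e -> 0 < p.2 ->
  layer e^-1 f i p <= (f true p.1 + f false p.1) / 2 +
    e / (4 * p.2) * `|f true p.1 - f false p.1|.
Proof.
move=> e0 p0; set s := 2 * e^-1 * p.2.
have s0 : 0 < s by rewrite !mulr_gt0// invr_gt0.
have es : expR (- s) <= s^-1.
  rewrite expRN lef_pV2 ?posrE ?expR_gt0//.
  by apply: le_trans (expR_ge1Dx s); rewrite lerDr.
have s4 : s^-1 / 2 = e / (4 * p.2).
  by rewrite /s; field; rewrite !gt_eqF.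
have e00 := expR_ge0 (- s).
rewrite -s4 /layer /relax -/s.
set a := expR (- s) in es e00 *.
have h : a * `|f true p.1 - f false p.1| <= s^-1 * `|f true p.1 - f false p.1|.
  exact: ler_wpM2r.
have h1 : a * (f true p.1 - f false p.1) <= a * `|f true p.1 - f false p.1|.
  by apply: ler_wpM2l => //; exact: ler_norm.
have h2 : a * (f false p.1 - f true p.1) <= a * `|f true p.1 - f false p.1|.
  by apply: ler_wpM2l => //; rewrite distrC; exact: ler_norm.
by case: i; move: h h1 h2; clear => *; lra.
Qed.

Lemma layer_upper T C (f : bool -> V -> R) (w : R -> bool -> S -> R) p eta :
  (forall i, continuous (f i)) ->
  (forall e, 0 < e -> forall i p, initial_strip T p ->
     w e i p <= layer e^-1 f i p + C * p.2) ->
  open_strip T p -> 0 < eta ->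
  eventually_at p (fun q e => forall i,
    w e i q <= (f true p.1 + f false p.1) / 2 + C * p.2 + eta).
Proof.
move=> cf hw sp eta0; have /andP[p0 pT] := sp.
pose G (q : S) := `|f true q.1 - f false q.1|.
pose g (q : S) := (f true q.1 + f false q.1) / 2 + C * q.2.
have cf1 i : continuous (fun q : S => f i q.1).
  by move=> q; apply: (@continuous_comp _ _ _ fst (f i)); [exact: cvg_fst|exact: cf].
have cG : {for p, continuous G}.
  by apply: cvg_norm; apply: cvgB; exact: cf1.
have cg : {for p, continuous g}.
  apply: cvgD; apply: cvgM; try exact: cvg_cst; last exact: cvg_snd.
  by apply: cvgD; exact: cf1.
have ct : {for p, continuous (fun q : S => q.2)} by exact: cvg_snd.
have eta2 : 0 < eta / 2 by rewrite divr_gt0.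
have p2 : 0 < p.2 / 2 by rewrite divr_gt0.
have A1 := eventually_at_nbhs (continuous_at_near cG ltr01).
have A2 := eventually_at_nbhs (continuous_at_near cg eta2).
have A3 := eventually_at_nbhs (continuous_at_near ct p2).
have A4 := eventually_at_nbhs (open_nbhs_nbhs (conj (@open_open_strip R n T) sp)).
have G1 : 0 < G p + 1 by rewrite ltr_wpDl// /G normr_ge0.
(* With [q.2 >= p.2 / 2] and [G q <= G p + 1], this smallness of [e] brings the layer term below
   [eta / 2]. *)
have A5 : eventually_at p (fun (q : S) e => e < eta * p.2 / (G p + 1)).
  exists (eta * p.2 / (G p + 1)); first by rewrite divr_gt0// mulr_gt0.
  by move=> q e _ /andP[].
apply: eventually_at_sub (eventually_atI (eventually_atI A1 A2) (eventually_atI A3 (eventually_atI A4 A5))).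
move=> q e e0 [[a1 a2] [a3 [a4 a5]]] i.
have /andP[q0 qT] := a4.
have iq : initial_strip T q by rewrite /initial_strip/= ltW.
apply: le_trans (hw e e0 i q iq) _.
have h := layer_le_mean f i e0 q0.
have GG : e / (4 * q.2) * `|f true q.1 - f false q.1| <= eta / 2.
  have q2 : p.2 / 2 <= q.2 by move: a3; rewrite ltr_norml => /andP[_]; clear => *; lra.
  have h1 : G q <= G p + 1 by move: a1; rewrite ltr_norml => /andP[]; clear => *; lra.
  rewrite mulrAC ler_pdivrMr ?mulr_gt0//.
  apply: (@le_trans _ _ (e * (G p + 1))); first by apply: ler_wpM2l => //; exact: ltW.
  apply: (@le_trans _ _ (eta * p.2)).
    by apply: ltW; rewrite -ltr_pdivlMr.
  have := ler_wpM2l (ltW eta0) q2; clear => *; lra.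
move: h GG a2; rewrite /g ltr_norml => h GG /andP[+ _].
move: h GG; clear => *; lra.
Qed.

Lemma system_solution_subsystem T e (H1 H2 : V -> V -> R) f1 f2 (u1 u2 : S -> R) :
  system_solution H1 H2 f1 f2 T e u1 u2 ->
  subsystem T (fun i x => pairb H1 H2 i (e^-1 *: x)) e^-1 (pairb u1 u2) /\
  subsystem T (fun i x => refl (pairb H1 H2 i) (e^-1 *: x)) e^-1
    (fun i p => - pairb u1 u2 i p).
Proof.
move=> [_ _ [s1 t1] [s2 t2]]; split=> -[] //=.
  apply: supersolution_refl t1 => phi p C1phi sp /=.
  rewrite (time_derivN C1phi sp) (space_gradN C1phi sp) /refl.
  by clear; ring.
apply: supersolution_refl t2 => phi p C1phi sp /=.
rewrite (time_derivN C1phi sp) (space_gradN C1phi sp) /refl.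
by clear; ring.
Qed.

Lemma cauchy_usc T f (u : S -> R) : cauchy_class T f u ->
  usc_in (initial_strip T) u /\ usc_in (initial_strip T) (fun p => - u p).
Proof.
move=> [cu _ _]; split; apply: within_continuous_usc_in => //.
by move=> p; apply: continuousN; exact: cu.
Qed.

Lemma linear_growthN T (u : S -> R) : linear_growth T u -> linear_growth T (fun p => - u p).
Proof. by move=> [K h]; exists K => p Tp; rewrite normrN; exact: h. Qed.

Lemma open_initial T : open_strip T `<=` (initial_strip T : set S).
Proof. by move=> p /andP[p0 pT]; rewrite /initial_strip/= ltW. Qed.

End Assembly.

(** * Growth and uniqueness for the effective problem *)

Section EffectiveProblem.
Context {R : realType} {n : nat}.
Notation V := 'rV[R]_n.
Notation S := ('rV[R]_n * R)%type.

Lemma continuous_bounded_cball (G : V -> R) r : continuous G ->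
  exists C, forall p, `|p| <= r -> `|G p| <= C.
Proof.
move=> cG; pose K := [set x : V | `|x| <= r].
have [K0|K0] := pselect (K !=set0); last first.
  by exists 0 => p pr; exfalso; apply: K0; exists p.
have uf : usc_in K (fun x => `|G x|).
  by apply: continuous_usc_in => x _; exact: (cvg_norm (cG x)).
have [x0 _ h] := usc_max_compact (@normr_cball_compact R n r) K0 uf.
by exists `|G x0| => p pr; exact: h.
Qed.

(** The scalar equation is the system with [k = 0] and two equal components, for which the layer
    reduces to [g]. This gives every effective solution the bounds demanded by [comparison]. *)
Lemma effective_growth T (Hbar : V -> R) (g : V -> R) M C w :
  (exists2 D, C1_with setT g D & forall x, `|\row_j D x (delta_mx 0 j) : V| <= M) ->
  continuous Hbar -> 0 <= C ->
  (forall q, `|q| <= M + 1 -> `|Hbar q| <= C) ->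
  effective_solution Hbar g T w ->
  forall p, initial_strip T p -> w p <= g p.1 + C * p.2 /\ - w p <= - g p.1 + C * p.2.
Proof.
move=> [D dg gM] cH C0 HC [cw [sub sup]] p Tp.
have [uw uwN] := cauchy_usc cw; have [_ gw w0] := cw.
have lay (f : V -> R) : layer 0 (fun=> f) true p = f p.1.
  by rewrite /layer; ring.
have Hb (G : V -> R) : continuous G -> bool -> locally_bounded_in_p (fun _ : V => G).
  move=> cG _ r; have [K hK] := continuous_bounded_cball r cG.
  by exists K => _ q; exact: hK.
split.
  have s : subsystem T (fun _ _ => Hbar) 0 (fun=> w).
    by move=> _ phi q C1phi sq tq; rewrite mul0r addr0; exact: sub.
  have := @layer_bound _ _ T 0 M _ _ (fun=> g) (fun=> D) (lexx 0) s (fun=> dg) (fun=> gM)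
    (fun=> uw) (fun=> w0) C C0 (fun=> gw) (Hb _ cH).
  rewrite -lay; apply=> //.
  by move=> _ _ q qM; have := HC q qM; rewrite ler_norml => /andP[].
have s : subsystem T (fun _ _ q => - Hbar (- q)) 0 (fun _ p => - w p).
  move=> _; apply: supersolution_refl sup => phi q C1phi sq.
  rewrite (time_derivN C1phi sq) (space_gradN C1phi sq).
  by ring.
have cHN : continuous (fun q : V => - Hbar (- q)).
  apply: (@continuous_dist R V) => x e e0.
  have /cvgrPdist_lt/(_ e e0)/near_dist_ltP[d d0 hd] := cH (- x).
  exists d => // y xy; rewrite opprK addrC distrC.
  by apply: hd; rewrite opprK addrC distrC.
have gMN x : `|\row_j - D x (delta_mx 0 j) : V| <= M.
  rewrite (_ : (\row_j _) = - \row_j D x (delta_mx 0 j)); first by rewrite normrN.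
  by apply/rowP => j; rewrite !mxE.
have w0N x : - w (x, 0) = - g x by rewrite w0.
have := @layer_bound _ _ T 0 M _ _ (fun _ x => - g x) (fun _ x v => - D x v) (lexx 0) s
  (fun=> C1_withN dg) (fun=> gMN) (fun=> uwN) (fun=> w0N) C C0 (fun=> linear_growthN gw) (Hb _ cHN).
rewrite -(lay (fun x => - g x)); apply=> //.
move=> _ _ q qM; have := HC (- q); rewrite normrN => /(_ qM).
by rewrite ler_norml lerN2 => /andP[].
Qed.

Lemma effective_unique T (Hbar : V -> R) (g : V -> R) M w1 w2 :
  (exists2 D, C1_with setT g D & forall x, `|\row_j D x (delta_mx 0 j) : V| <= M) ->
  continuous Hbar -> loc_unif_continuous Hbar ->
  effective_solution Hbar g T w1 -> effective_solution Hbar g T w2 ->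
  forall p, initial_strip T p -> w1 p <= w2 p.
Proof.
move=> dg cH lH s1 s2 p Tp.
have [C hC] := continuous_bounded_cball (M + 1) cH.
have [D dD DM] := dg.
have M0 : 0 <= M by exact: le_trans (DM 0).
have C0 : 0 <= C.
  have := hC 0; rewrite normr0 => /(_ (addr_ge0 M0 ler01)); exact: le_trans.
have g1 := effective_growth dg cH C0 hC s1.
have g2 := effective_growth dg cH C0 hC s2.
have [uw1 _] := cauchy_usc s1.1; have [_ uw2] := cauchy_usc s2.1.
have /andP[p0 pT] := Tp; have [p00|pp] := eqVneq p.2 0.
  have [_ _ a1] := s1.1; have [_ _ a2] := s2.1.
  by rewrite [p]surjective_pairing p00 a1 a2.
have sp : open_strip T p by rewrite /open_strip/= pT lt_neqAle eq_sym pp p0.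
have oi := @open_initial R n T.
have := comparison lH (mulr_ge0 (ler0n R n) M0) C0 (lipschitz_of_grad dD DM)
  (usc_in_sub oi uw1) (usc_in_sub oi uw2) _ _ s1.2.1 s2.2.2 sp sp.
rewrite !subrr !normr0 !mulr0 addr0 subr_le0; apply.
  by move=> q /oi /g1[].
by move=> q /oi /g2[_]; rewrite lerNl opprD opprK.
Qed.

End EffectiveProblem.

Section Limit.
Context {R : realType} {n : nat}.
Notation V := 'rV[R]_n.
Notation S := ('rV[R]_n * R)%type.

(* [U] is the common value of the upper and lower half-relaxed limits. *)
Lemma half_relaxed_limit (T : R) (H1 H2 : V -> V -> R) (f1 f2 Hbar : V -> R)
    (u1 u2 : R -> S -> R) :
  hamiltonian H1 -> hamiltonian H2 -> initial_datum f1 -> initial_datum f2 ->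
  effective_hamiltonian H1 H2 Hbar ->
  (forall eps, 0 < eps -> system_solution H1 H2 f1 f2 T eps (u1 eps) (u2 eps)) ->
  let g x := (f1 x + f2 x) / 2 in
  exists M C (U : S -> R), [/\ 0 <= C,
    exists2 D, C1_with setT g D & forall x, `|\row_j D x (delta_mx 0 j) : V| <= M,
    (forall p, open_strip T p -> `|U p - g p.1| <= C * p.2) /\
    (forall p q, open_strip T p -> open_strip T q ->
       `|U p - U q| <= n%:R * M * `|p.1 - q.1| + C * `|p.2 - q.2|),
    forall p e, open_strip T p -> 0 < e ->
      eventually_at p (fun q eps => `|u1 eps q - U p| < e /\ `|u2 eps q - U p| < e) &
    viscosity_solution (open_strip T)
      (fun phi p => time_deriv phi p + Hbar (space_grad phi p)) U].
Proof.
move=> hH1 hH2 [C1f1 [M1 hM1]] [C1f2 [M2 hM2]] eff sol g.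
pose H := pairb H1 H2; pose f := pairb f1 f2.
pose Df i (x v : V) := 'D_v (f i) x.
pose w e := pairb (u1 e) (u2 e).
pose M := Num.max M1 M2.
have hf i : C1_with setT (f i) (Df i) by case: i; exact: C1_on_with.
have fM i x : `|\row_j Df i x (delta_mx 0 j) : V| <= M.
  by case: i; rewrite le_max; [rewrite hM1|rewrite hM2 orbT].
have M0 : 0 <= M by exact: le_trans (fM true 0).
have [C1 hC1] := hamiltonian_locally_bounded hH1 (M + 1).
have [C2 hC2] := hamiltonian_locally_bounded hH2 (M + 1).
(* A bound on [H] over all [xi] is unaffected by the substitution [xi = x / eps]; this makes the
   barriers uniform in [eps]. *)
pose C := Num.max C1 C2.
have HC i xi q : `|q| <= M + 1 -> `|H i xi q| <= C.
  by move=> qM; case: i; rewrite le_max; [rewrite hC1|rewrite hC2 ?orbT].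
have C0 : 0 <= C.
  by have := HC true 0 0; rewrite normr0 => /(_ (addr_ge0 M0 ler01)); exact: le_trans.
have cf i : continuous (f i).
  by move=> x; apply: differentiable_continuous; have [? _] := hf i x I; exact: ex_diff.
have oi := @open_initial R n T.
have uscw e i : 0 < e -> usc_in (initial_strip T) (w e i) /\
    usc_in (initial_strip T) (fun p => - w e i p).
  by move=> /sol[c1 c2 _ _]; case: i; [exact: cauchy_usc c1|exact: cauchy_usc c2].
have groww e i : 0 < e -> linear_growth T (w e i).
  by move=> /sol[[_ h1 _] [_ h2 _] _ _]; case: i.
have w0 e i x : 0 < e -> w e i (x, 0) = f i x.
  by move=> /sol[[_ _ h1] [_ _ h2] _ _]; case: i; [exact: h1|exact: h2].
have up e : 0 < e -> forall i p, initial_strip T p ->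
    w e i p <= layer e^-1 f i p + C * p.2.
  move=> e0; have ei0 : 0 <= e^-1 by rewrite invr_ge0 ltW.
  apply: (layer_bound ei0 (system_solution_subsystem (sol e e0)).1 hf fM
    (fun i => (uscw e i e0).1) (fun i x => w0 e i x e0) C0 (fun i => groww e i e0)).
    have lbH j : locally_bounded_in_p (H j).
      by case: j; exact: hamiltonian_locally_bounded.
    by move=> i r; have [K hK] := lbH i r; exists K => xi q; exact: hK.
  by move=> i xi q qM; have := HC i (e^-1 *: xi) q qM; rewrite ler_norml => /andP[].
have lo e : 0 < e -> forall i p, initial_strip T p ->
    - w e i p <= layer e^-1 (fun i x => - f i x) i p + C * p.2.
  move=> e0; have ei0 : 0 <= e^-1 by rewrite invr_ge0 ltW.
  have fMN i x : `|\row_j - Df i x (delta_mx 0 j) : V| <= M.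
    rewrite (_ : (\row_j _) = - \row_j Df i x (delta_mx 0 j)); first by rewrite normrN.
    by apply/rowP => j; rewrite !mxE.
  have w0N i x : - w e i (x, 0) = - f i x by rewrite w0.
  apply: (layer_bound ei0 (system_solution_subsystem (sol e e0)).2 (fun i => C1_withN (hf i)) fMN
    (fun i => (uscw e i e0).2) w0N C0 (fun i => linear_growthN (groww e i e0))).
    have lbH j : locally_bounded_in_p (refl (H j)).
      by case: j; [have [] := hamiltonian_regular_refl hH1|have [] := hamiltonian_regular_refl hH2].
    by move=> i r; have [K hK] := lbH i r; exists K => xi q; exact: hK.
  move=> i xi q qM; have := HC i (e^-1 *: xi) (- q); rewrite normrN => /(_ qM).
  by rewrite ler_norml lerN2 => /andP[].
pose wN e i p := - w e i p.
have evu p eta : open_strip T p -> 0 < eta ->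
    eventually_at p (fun q e => forall i, w e i q <= g p.1 + C * p.2 + eta).
  by move=> sp eta0; exact: layer_upper cf up sp eta0.
have cfN i : continuous (fun x => - f i x) by move=> x; exact: (cvgN (cf i x)).
have evl p eta : open_strip T p -> 0 < eta ->
    eventually_at p (fun q e => forall i, wN e i q <= - g p.1 + C * p.2 + eta).
  move=> sp eta0; have := layer_upper cfN lo sp eta0.
  by rewrite /g -opprD mulNr.
have lb p : open_strip T p -> locally_bounded_at w p.
  move=> sp; exists (`|g p.1| + C * p.2 + 1).
  apply: eventually_at_sub (eventually_atI (evu p 1 sp ltr01) (evl p 1 sp ltr01)).
  move=> q e e0 [h1 h2] i; rewrite ler_norml.
  have := h1 i; have := h2 i; rewrite /wN; have := ler_norm (g p.1); have := ler_norm (- g p.1).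
  by rewrite normrN; clear => *; apply/andP; split; lra.
have lbN p : open_strip T p -> locally_bounded_at wN p.
  by move=> /lb; exact: locally_bounded_atN.
have Ug p : open_strip T p -> ulim w p <= g p.1 + C * p.2.
  move=> sp; apply/ler_addgt0Pr => e e0; apply: ulim_le; first exact: lb.
  exact: evu.
have UNg p : open_strip T p -> ulim wN p <= - g p.1 + C * p.2.
  move=> sp; apply/ler_addgt0Pr => e e0; apply: ulim_le; first exact: lbN.
  exact: evl.
have subU : viscosity_subsolution (open_strip T)
    (fun phi p => time_deriv phi p + Hbar (space_grad phi p)) (ulim w).
  apply: (@ulim_subsolution _ _ T H Hbar w) => //.
  - by case; exact: hamiltonian_regular.
  - move=> P; have [v [cv pv _ sv]] := cell_solvable_bool (eff P).1.
    by exists v.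
  - by move=> e e0; exact: (system_solution_subsystem (sol e e0)).1.
  - by move=> e i e0; exact: usc_in_sub oi (uscw e i e0).1.
have subUN : viscosity_subsolution (open_strip T)
    (fun phi p => time_deriv phi p + - Hbar (- space_grad phi p)) (ulim wN).
  apply: (@ulim_subsolution _ _ T (fun i => refl (H i)) (fun P => - Hbar (- P)) wN) => //.
  - by case; exact: hamiltonian_regular_refl.
  - move=> P; have [v [cv pv sv _]] := cell_solvable_bool (eff (- P)).1.
    exists (fun i x => - v i x); split.
    + by move=> i x; exact: (cvgN (cv i x)).
    + by move=> i xi z; rewrite pv.
    + by have := cell_sub_refl sv; rewrite opprK.
  - by move=> e e0; exact: (system_solution_subsystem (sol e e0)).2.
  - by move=> e i e0; exact: usc_in_sub oi (uscw e i e0).2.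
have supUN : viscosity_supersolution (open_strip T)
    (fun phi p => time_deriv phi p + Hbar (space_grad phi p)) (fun p => - ulim wN p).
  apply: subsolution_refl subUN => phi p C1phi sp.
  rewrite (time_derivN C1phi sp) (space_gradN C1phi sp) opprK.
  by clear; ring.
have L0 : 0 <= n%:R * M by exact: mulr_ge0.
have dg : exists2 D, C1_with setT g D & forall x, `|\row_j D x (delta_mx 0 j) : V| <= M.
  exists (fun x v => 2^-1 * (Df true x v + Df false x v)).
    apply: (C1_with_ext _ _ (C1_withZ 2^-1 (C1_withD (hf true) (hf false)))) => // x.
    by rewrite /g mulrC.
  move=> x; apply: rVnorm_le => // j; rewrite mxE normrM gtr0_norm ?invr_gt0//.
  have := le_trans (coord_le_norm _ j) (fM true x); rewrite mxE => a1.
  have := le_trans (coord_le_norm _ j) (fM false x); rewrite mxE => a2.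
  have := ler_normD (Df true x (delta_mx 0 j)) (Df false x (delta_mx 0 j)).
  by move: a1 a2; clear => *; lra.
have [D dD DM] := dg.
have cmp := comparison (effective_loc_unif_continuous hH1 hH2 eff) L0 C0
  (lipschitz_of_grad dD DM) (usc_ulim lb) _ Ug _ subU supUN.
have cmp2 p q : open_strip T p -> open_strip T q ->
    ulim w p - - ulim wN q <= n%:R * M * `|p.1 - q.1| + C * `|p.2 - q.2|.
  apply: cmp.
    rewrite (_ : (fun p => - - ulim wN p) = ulim wN); first exact: usc_ulim.
    by apply/funext => r; rewrite opprK.
  by move=> r /UNg; rewrite lerNr opprD opprK.
(* The lower limit is at most the upper one by construction; the comparison estimate at two equal
   points gives the reverse inequality. *)
have UE p : open_strip T p -> - ulim wN p = ulim w p.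
  move=> sp; apply/eqP; rewrite eq_le; apply/andP; split.
    exact: llim_le_ulim (lb p sp).
  rewrite -subr_le0.
  by apply: le_trans (cmp2 p p sp sp) _; rewrite !subrr !normr0 !mulr0 addr0.
have cvgU p e : open_strip T p -> 0 < e -> eventually_at p (fun q eps =>
    (forall i, w eps i q < ulim w p + e) /\ (forall i, wN eps i q < ulim wN p + e)).
  move=> sp e0; apply: eventually_atI; apply: ulim_lt; try by rewrite ltrDl.
    exact: lb.
  exact: lbN.
move: (ulim w) (ulim wN) Ug UNg cmp2 UE subU supUN cvgU => U UN.
move=> Ug UNg cmp2 UE subU supUN cvgU.
exists M, C, U; split=> //.
- split=> [p sp|p q sp sq].
    have := Ug p sp; have := UNg p sp; have := UE p sp.
    by rewrite ler_norml; clear => *; apply/andP; split; lra.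
  have h1 := cmp2 p q sp sq; have h2 := cmp2 q p sq sp.
  rewrite (distrC q.1) (distrC q.2) in h2.
  rewrite ler_norml; move: h1 h2 (UE p sp) (UE q sq).
  by clear => *; apply/andP; split; lra.
- move=> p e sp e0; apply: eventually_at_sub (cvgU p e sp e0).
  move=> q eps eps0 [a b]; have := a true; have := b true; have := a false; have := b false.
  rewrite /wN /w /= !ltr_norml; move: (UE p sp).
  by clear => *; split; apply/andP; split; lra.
split=> // phi p C1phi sp tp; apply: supUN => //.
apply: (touches_below_eq (@open_open_strip R n T) sp _ tp) => q sq.
by rewrite UE.
Qed.

End Limit.

Theorem theorem1p2 (R : realType) (n : nat) (T : R)
    (H1 H2 : 'rV[R]_n -> 'rV[R]_n -> R) (f1 f2 : 'rV[R]_n -> R)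
    (Hbar : 'rV[R]_n -> R) (u1 u2 : R -> 'rV[R]_n * R -> R) :
  0 < T ->
  hamiltonian H1 -> hamiltonian H2 ->
  initial_datum f1 -> initial_datum f2 ->
  effective_hamiltonian H1 H2 Hbar ->
  (forall eps : R, 0 < eps ->
    system_solution H1 H2 f1 f2 T eps (u1 eps) (u2 eps)) ->
  exists u : 'rV[R]_n * R -> R,
    [/\ [lipschitz u p | p in closed_strip T],
        locally_uniform_cvg (open_strip T) u1 u,
        locally_uniform_cvg (open_strip T) u2 u,
        effective_solution Hbar (fun x => (f1 x + f2 x) / 2) T u
      & forall w : 'rV[R]_n * R -> R,
          effective_solution Hbar (fun x => (f1 x + f2 x) / 2) T w ->
          forall p, initial_strip T p -> w p = u p].
Proof.
move=> T0 hH1 hH2 hf1 hf2 eff sol.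
have [M [C [U [C0 dg [Ug UL] Ucvg [Usub Usup]]]]] := half_relaxed_limit hH1 hH2 hf1 hf2 eff sol.
have M0 : 0 <= M by have [D _ h] := dg; exact: le_trans (h 0).
pose K := n%:R * M + C.
have nM0 : 0 <= n%:R * M by exact: mulr_ge0.
have K0 : 0 <= K by exact: addr_ge0.
have UK p q : open_strip T p -> open_strip T q -> `|U p - U q| <= K * `|p - q|.
  move=> sp sq; apply: le_trans (UL p q sp sq) _; rewrite mulrDl.
  by apply: lerD; apply: ler_wpM2l => //; [exact: (fst_norm_le (p - q))|exact: (snd_norm_le (p - q))].
have s0 : (open_strip T : set ('rV[R]_n * R)) !=set0.
  by exists (0, T / 2); rewrite /open_strip/=; move: T0; clear => *; apply/andP; split; lra.
(* The extension lives on all of space-time, so continuity up to [t = 0], linear growth and the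
   Lipschitz bound on the closed strip all follow from one global estimate. *)
have [u [uU uK]] := lipschitz_extension s0 UK K0.
have oO := @open_open_strip R n T.
have cud p e : 0 < e -> exists2 d, 0 < d & forall q, `|p - q| < d -> `|u p - u q| < e.
  move=> e0; exists (e / (K + 1)).
    by rewrite divr_gt0// ltr_wpDl.
  move=> q; rewrite ltr_pdivlMr ?ltr_wpDl// => h.
  apply: le_lt_trans (uK p q) _; apply: le_lt_trans h.
  by rewrite mulrC; apply: ler_wpM2l => //; rewrite lerDl.
have cu : continuous u := continuous_dist cud.
have u0 x : u (x, 0) = (f1 x + f2 x) / 2.
  apply/eqP; rewrite -subr_eq0 -normr_le0; apply/ler_addgt0Pr => e e0; rewrite add0r.
  (* [u (x, t)] is within [K t] of [u (x, 0)] and within [C t] of the mean; this [t] makes the total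
     at most [e] while staying in the strip. *)
  pose t := Num.min (T / 2) (e / (K + C + 1)).
  have KC : 0 < K + C + 1 by rewrite ltr_wpDl// addr_ge0.
  have t0 : 0 < t by rewrite lt_min !divr_gt0.
  have tT : t < T.
    by apply: (@le_lt_trans _ _ (T / 2)); [rewrite ge_min lexx|move: T0; clear => *; lra].
  have st : open_strip T (x, t) by rewrite /open_strip/= t0.
  have te : (K + C + 1) * t <= e by rewrite mulrC -ler_pdivlMr// ge_min lexx orbT.
  have := Ug _ st; rewrite -(uU _ st) /= => h1.
  have := uK (x, 0) (x, t).
  rewrite (_ : `|(x, 0) - (x, t)| = t); last first.
    apply/eqP; rewrite eq_le; apply/andP; split.
      by apply/norm_pair_le; rewrite subrr normr0 sub0r normrN gtr0_norm// lexx ltW.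
    by apply: le_trans (snd_norm_le _); rewrite /= sub0r normrN ler_norm.
  have := ler_distD (u (x, t)) (u (x, 0)) ((f1 x + f2 x) / 2).
  by move: h1 te t0; clear => *; lra.
have effu : effective_solution Hbar (fun x => (f1 x + f2 x) / 2) T u.
  split; first split=> //.
  - exact: continuous_subspaceT.
  - exists (`|u 0| + K * T + K) => p /andP[p0 pT].
    have := uK p 0; rewrite subr0 => h.
    have pp : `|p| <= `|p.1| + T.
      rewrite {1}[p]surjective_pairing; apply/norm_pair_le; split.
        by rewrite lerDl ltW.
      by rewrite ger0_norm// (le_trans (ltW pT))// lerDr.
    have := ler_wpM2l K0 pp; have := ler_normD (u p - u 0) (u 0); rewrite subrK.
    have := mulr_ge0 (normr_ge0 (u 0)) (normr_ge0 p.1).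
    have := mulr_ge0 (mulr_ge0 K0 (ltW T0)) (normr_ge0 p.1).
    by move: h; clear -K0; move: K0 => + *; lra.
  - split=> phi p C1phi sp tp.
      by apply: Usub => //; apply: (touches_above_eq oO sp _ tp) => q; exact: uU.
    by apply: Usup => //; apply: (touches_below_eq oO sp _ tp) => q; exact: uU.
(* [Ucvg] compares with the value at the fixed point [p]; continuity of [u] replaces it by the value
   at the moving point, the form to which compactness applies. *)
have luc p e : open_strip T p -> 0 < e -> eventually_at p (fun q eps =>
    `|u q - u1 eps q| < e /\ `|u q - u2 eps q| < e).
  move=> sp e0; have e2 : 0 < e / 2 by rewrite divr_gt0.
  have [d d0 hd] := cud p _ e2.
  have near_p : eventually_at p (fun q _ => `|u p - u q| < e / 2).
    by exists d => // q eps pq _; exact: hd.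
  apply: eventually_at_sub (eventually_atI (Ucvg p _ sp e2) near_p).
  move=> q eps eps0 [[]]; rewrite -(uU p sp) !ltr_norml.
  move=> /andP[a1 a2] /andP[a3 a4] /andP[a5 a6].
  by move: a1 a2 a3 a4 a5 a6; clear => *; split; apply/andP; split; lra.
exists u; split=> //.
- exists K; split=> [|N KN [p q] _]; first exact: num_real.
  by apply: le_trans (uK p q) _; apply: ler_wpM2r => //; exact: ltW.
- move=> A cA AO; apply: uniform_cvg_dist => e e0.
  have [|d d0 h] := eventually_at_compact (Q := fun q eps => `|u q - u1 eps q| < e) cA.
    move=> p /AO sp; apply: eventually_at_sub (luc p e sp e0).
    by move=> q eps _ [].
  by exists d => // eps p ed Ap; exact: h.
- move=> A cA AO; apply: uniform_cvg_dist => e e0.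
  have [|d d0 h] := eventually_at_compact (Q := fun q eps => `|u q - u2 eps q| < e) cA.
    move=> p /AO sp; apply: eventually_at_sub (luc p e sp e0).
    by move=> q eps _ [].
  by exists d => // eps p ed Ap; exact: h.
move=> w effw p Tp.
have cH := effective_continuous hH1 hH2 eff.
have lH := effective_loc_unif_continuous hH1 hH2 eff.
apply/eqP; rewrite eq_le; apply/andP; split.
  exact: effective_unique dg cH lH effw effu _ Tp.
exact: effective_unique dg cH lH effu effw _ Tp.
Qed.
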